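(* Let $g$ be a fixed integer with $|g|\ge 2$. Then $$\#\left(\mathcal{P}_x\cap(0,M(x)]\right)=(1+o(1))\frac{2^{\omega(g)}M(x)}{e^{\gamma}\,\varphi(\mathrm{rad}(g))\,I_g(x)\log x},\qquad x\to\infty.$$
   Context: For a real number $x$, $M(x)$ denotes the product of all primes $p\le x$. $\gamma$ is the Euler–Mascheroni constant, $\varphi$ is Euler's function, $\omega(g)$ is the number of distinct prime factors of $g$, and $\mathrm{rad}(g)$ is the product of the distinct prime factors of $g$. For a prime $p\nmid g$, $l_g(p)$ is the multiplicative order of $g$ modulo $p$, and $i_g(p)=(p-1)/l_g(p)$. Put $I_g(x)=\prod_{p\le x,\ p\nmid g} i_g(p)$, the product being over primes $p$. A power of $g$ means an integer $g^k$ with integer exponent $k\ge 0$, and an integer $n$ is a power of $g$ modulo a prime $p$ if $n\equiv g^k\pmod p$ for some integer $k\ge 0$ (this applies also to primes $p\mid g$, for which the condition says $n\equiv 0$ or $1\pmod p$). An $x$-pseudopower to base $g$ is an integer $n>0$ that is not a power of $g$ over the integers but is a power of $g$ modulo every prime $p\le x$. $\mathcal{P}_x$ denotes the set of all $x$-pseudopowers to base $g$. *)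

(* Defs.v *)
From HB Require Import structures.
From mathcomp Require Import all_boot all_order all_algebra all_fingroup finmap.
From mathcomp Require Import all_classical all_reals all_analysis.
Set Implicit Arguments.
Unset Strict Implicit.
Unset Printing Implicit Defensive.
Import Order.TTheory GRing.Theory Num.Theory.
Import numFieldNormedType.Exports.
Local Open Scope classical_set_scope.
Local Open Scope ring_scope.

Definition euler_gamma (R : realType) : R :=
  limn (fun n : nat => (\sum_(1 <= k < n.+1) k%:R^-1) - ln (n%:R : R)).

(* For a natural number p, p < (Num.truncn x).+1 iff p%:R <= x, except when
   x < 0 and p = 0, which is not prime. *)
Definition primorial (R : realType) (x : R) : nat :=
  (\prod_(p < (Num.truncn x).+1 | prime p) p)%N.

Definition prime_omega (g : int) : nat := size (primes `|g|%N).

Definition radical (g : int) : nat := (\prod_(p <- primes `|g|%N) p)%N.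

(* Multiplicative order of g modulo a prime p not dividing g: the order of the
   class of g in the unit group of 'F_p.  The default value 1 of insubd is
   used only when that class is not a unit, i.e. when p divides g. *)
Definition mult_order (g : int) (p : nat) : nat :=
  #[insubd (1%g : {unit 'F_p}) (g%:~R : 'F_p)]%g.

Definition residual_index (g : int) (p : nat) : nat :=
  (p.-1 %/ mult_order g p)%N.

Definition index_prod (R : realType) (g : int) (x : R) : nat :=
  (\prod_(p < (Num.truncn x).+1 | prime p && ~~ (p %| g)%Z)
     residual_index g p)%N.

Definition is_power (g n : int) : Prop := exists k : nat, n = g ^+ k.

Definition is_power_mod (g : int) (p : nat) (n : int) : Prop :=
  exists k : nat, (n = g ^+ k %[mod p])%Z.

Definition pseudopowers (R : realType) (g : int) (x : R) : set int :=
  [set n : int | [/\ 0 < n, ~ is_power g n &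
     forall p : nat, prime p -> p%:R <= x -> is_power_mod g p n]].

(* The set counted is finite, so fset_set does not take its default value. *)
Definition pseudopower_count (R : realType) (g : int) (x : R) : nat :=
  #|` fset_set (pseudopowers g x `&`
                [set n : int | 0 < n <= (primorial x)%:Z]) |%fset.

(* Main.v *)
Require Import Defs.
From HB Require Import structures.
From mathcomp Require Import all_boot all_order all_algebra all_fingroup finmap.
From mathcomp Require Import all_classical all_reals all_analysis.
From mathcomp Require Import ring lra.
Import Order.TTheory GRing.Theory Num.Theory.
Import numFieldNormedType.Exports.
Local Open Scope classical_set_scope.
Local Open Scope ring_scope.

(**
Write [n] for the integer part of [x] and [M] for the product of the primes up
to [x]. Being a power of [g] modulo a prime [p] is a condition on the residue
modulo [p]; it is satisfied by [l_g(p)] residues if [p] does not divide [g],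
and by the two residues 0 and 1 if it does. By the Chinese remainder theorem,
the number of integers in [(0, M]] that satisfy it for all [p <= x] is
exactly the product [N] of these numbers (count_power_residues). Since
[l_g(p) i_g(p) = p - 1], for [x >= |g|] this product is
[2^omega(g) * prod_(p <= x) (p - 1) / (phi(rad g) * I_g(x))]
(residue_total), and [prod_(p <= x) (p - 1) = M * prod_(p <= x) (1 - 1/p)].
Two facts remain.

The pseudopowers are the integers counted by [N] minus the true powers of
[g], of which there are at most [log_2 M + 1 = O(x)]. This is [o(N)]
(powers_negligible): a prime at which [g] has order less than 16 divides some
nonzero [g^l - 1] with [l < 16], hence is bounded, so that [N] grows at least
like [16^pi(x)], while [pi(2^K) >= K/2 - 3].

Mertens' third theorem, [prod_(p <= x) (1 - 1/p) ~ e^(-gamma) / log x]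
(mertens_third), is proved along the powers of 2, which suffices because the
product is monotone. Let [beta_k] be the sum of [-log(1 - 1/p)] over
[2^k < p <= 2^(k+1)].
- Mertens' first theorem, which rests on Chebyshev's bound and on the
  factorization of [n!], says that the sum of [log p / p] over [p <= 2^K] is
  [K log 2 + O(1)]: divided by [log 2], the block sums of [log p / p] differ
  from 1 by terms with bounded partial sums. Dirichlet's test then shows
  that the series of [beta_k - 1/(k+1)] converges
  (block_prime_log_cvg), say to [C].
- To find [C], put [z = 2^(-d)] with [d -> 0]. By Abel's theorem [C] is the
  limit of [sum beta_k z^(k+1) - sum z^(k+1)/(k+1)]. On the block [k], the
  weight [z^(k+1)] agrees with [p^(-d)] up to a factor [z], so the first sum is
  [log zeta(1+d) + o(1) = -log d + o(1)] by the Euler product; the second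
  one is [-log(1 - z) = -log d - log log 2 + o(1)]. Hence [C = log log 2]
  (block_prime_log_lim). Comparing with the harmonic numbers in this way
  brings in [gamma] through its definition, without the Gamma function.
*)

(** * Chebyshev's upper bound *)

Lemma leq_bin_pow2 n m : ('C(n, m) <= 2 ^ n)%N.
Proof.
have [mn|nm] := leqP m n; last by rewrite bin_small.
have := expnDn 1 1 n; rewrite addn1 => ->.
rewrite (bigD1 (inord m)) //= inordK // !exp1n !muln1.
exact: leq_addr.
Qed.

(** Every prime in [(m, 2m]] divides [(2m)!] but not [m!]. *)
Lemma prod_primes_le_bin (m : nat) :
  (\prod_(m.+1 <= p < (m.*2).+1 | prime p) p <= 'C(m.*2, m))%N.
Proof.
apply: dvdn_leq; first by rewrite bin_gt0 -addnn leq_addr.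
have H := @unstable.Gauss_dvd_prod nat (index_iota m.+1 (m.*2).+1) prime id.
apply/H.
  rewrite map_id.
  have /(sub_in_pairwise (P := prime)) : {in prime &, subrel [rel x y | x != y] coprime}.
    move=> p q pp pq /= neq.
    by rewrite prime_coprime// dvdn_prime2.
  apply; first exact: filter_all.
  by rewrite -uniq_pairwise filter_uniq// iota_uniq.
move=> p; rewrite mem_index_iota => /andP[mp pm] pp.
have nd k : (k < p)%N -> ~~ (p %| k`!)%N.
  elim: k => [|k IH] kp; first by rewrite fact0 dvdn1 neq_ltn prime_gt1 ?orbT.
  by rewrite factS Euclid_dvdM// negb_or IH 1?ltnW// gtnNdvd.
have : (p %| (m.*2)`!)%N by rewrite dvdn_fact// prime_gt0.
rewrite -(@bin_fact m.*2 m) -?addnn ?leq_addr// addnK addnn.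
by rewrite !Euclid_dvdM// => /orP[//|]; rewrite orbb (negbTE (nd m mp)).
Qed.

(** Passing from [2^k] to [2^(k+1)] multiplies the product by at most
[4^(2^k)], that is, squares the bound. *)
Lemma chebyshev_upper (k : nat) :
  (\prod_(0 <= p < (2 ^ k).+1 | prime p) p <= 4 ^ (2 ^ k))%N.
Proof.
elim: k => [|k IH].
  by rewrite expn0 unlock.
have e2 : (2 ^ k.+1 = (2 ^ k).*2)%N by rewrite expnS mul2n.
rewrite (@big_cat_nat _ _ _ (2 ^ k).+1)//=; last first.
  by rewrite ltnS leq_exp2l.
rewrite (_ : (4 ^ _ = 4 ^ (2 ^ k) * 4 ^ (2 ^ k))%N); last by rewrite -expnD addnn e2.
apply: leq_mul => //; rewrite e2.
apply: leq_trans (prod_primes_le_bin _) _.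
apply: leq_trans (leq_bin_pow2 _ _) _.
by rewrite -mul2n expnM.
Qed.

(** * Mertens' first theorem *)

Lemma fact_prod_primes n :
  (n`! = \prod_(0 <= p < n.+1 | prime p) p ^ logn p n`!)%N.
Proof.
have nn : (n <= n`!)%N.
  by case: n => // n; rewrite factS leq_pmulr// fact_gt0.
rewrite -[LHS]partnT ?fact_gt0// /partn (@big_cat_nat _ _ _ n.+1)//=.
rewrite [X in (_ * X)%N]big1_seq ?muln1; last first.
  move=> p /andP[_]; rewrite mem_index_iota => /andP[np _].
  have [pp|npp] := boolP (prime p); last by rewrite lognE (negbTE npp).
  rewrite logn_fact// big1_seq// => k /andP[_]; rewrite mem_index_iota => /andP[k1 _].
  by rewrite divn_small// (leq_trans np)// -{1}(expn1 p) leq_pexp2l// prime_gt0.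
rewrite [RHS]big_mkcond/=; apply: eq_bigr => p _.
by case: ifP => // npp; rewrite lognE npp.
Qed.

Lemma ln_prod (R : realType) (I : Type) (r : seq I) (P : pred I) (F : I -> R) :
  (forall i, P i -> 0 < F i) ->
  ln (\prod_(i <- r | P i) F i) = \sum_(i <- r | P i) ln (F i).
Proof.
move=> F0; pose Q (x y : R) := 0 < x /\ ln x = y.
suff [//] : Q (\prod_(i <- r | P i) F i) (\sum_(i <- r | P i) ln (F i)).
apply: (big_ind2 Q) => [|x1 x2 y1 y2 [x0 <-] [y0 <-]|i Pi].
- by split; rewrite ?ln1.
- by split; [exact: mulr_gt0|rewrite lnM].
- by split=> //; exact: F0.
Qed.

Lemma ln_fact_primes (R : realType) n :
  ln (n`!%:R : R) = \sum_(0 <= p < n.+1 | prime p) (logn p n`!)%:R * ln p%:R.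
Proof.
rewrite {1}fact_prod_primes natr_prod.
rewrite ln_prod => [|p pp]; last by rewrite ltr0n expn_gt0 prime_gt0.
apply: eq_bigr => p pp; have p0 : 0 < p%:R :> R by rewrite ltr0n prime_gt0.
by rewrite natrX lnXn// mulr_natl.
Qed.

Lemma logn_fact_lower (R : realType) p n : prime p ->
  n%:R / p%:R - 1 <= (logn p n`!)%:R :> R.
Proof.
move=> pp; have p0 : 0 < p%:R :> R by rewrite ltr0n prime_gt0.
rewrite lerBlDr ler_pdivrMr// natr1 -natrM ler_nat.
case: n => [//|n]; rewrite logn_fact// big_nat_recl// expn1.
rewrite {1}(divn_eq n.+1 p) mulSn addnC leq_add ?(ltnW (ltn_pmod _ _)) ?prime_gt0//.
by rewrite leq_mul2r leq_addr orbT.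
Qed.

(** Legendre's formula and the geometric bound [sum_k n/p^k <= n/(p-1)],
cleared of denominators. The induction carries the remainder [n %/ p^m]. *)
Lemma logn_fact_upper p n : prime p -> (logn p n`! * p.-1 <= n)%N.
Proof.
move=> pp; have p1 := prime_gt1 pp; rewrite logn_fact//.
have H m : (\sum_(1 <= k < m.+1) n %/ p ^ k * p.-1 + n %/ p ^ m <= n)%N.
  elim: m => [|m IH]; first by rewrite big_nil expn0 divn1.
  rewrite big_nat_recr//= -addnA (leq_trans _ IH)// leq_add2l.
  rewrite -mulnSr prednK ?prime_gt0// expnSr divnMA.
  exact: leq_trunc_div.
by rewrite big_distrl/=; apply: leq_trans (H n); rewrite leq_addr.
Qed.

Lemma ln2_bounds (R : realType) : 1 / 2 <= ln 2 :> R /\ ln 2 <= 1 :> R.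
Proof.
split; last by have := @le_ln1Dx R 1; rewrite -[1 + 1]/(2%:R); apply; lra.
have := @le_ln1Dx R (- (1 / 2)).
rewrite (_ : 1 + - (1 / 2) = 2^-1); last by lra.
rewrite lnV ?posrE//; lra.
Qed.

Lemma ln_fact_le (R : realType) n : ln (n`!%:R : R) <= n%:R * ln n%:R.
Proof.
elim: n => [|n IH]; first by rewrite ln1 mul0r.
rewrite factS natrM lnM ?posrE ?ltr0n ?fact_gt0// -natr1 mulrDl mul1r addrC lerD2r.
apply: (le_trans IH); rewrite ler_wpM2l// natr1.
have [->|n0] := posnP n; first by rewrite ln0 ?ln1.
by rewrite ler_ln ?posrE ?ltr0n// ler_nat.
Qed.

Lemma ln_succ_le (R : realType) n : (0 < n)%N ->
  ln n.+1%:R - ln n%:R <= n%:R^-1 :> R.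
Proof.
move=> n0; have n0R : 0 < n%:R :> R by rewrite ltr0n.
rewrite -ln_div ?posrE ?ltr0n// -natr1 mulrDl divff ?gt_eqF// mul1r.
by apply: le_ln1Dx; apply: lt_trans (_ : 0 < _); rewrite ?invr_gt0// oppr_lt0.
Qed.

Lemma ln_fact_ge (R : realType) n : n%:R * ln n%:R - n%:R <= ln (n`!%:R : R).
Proof.
elim: n => [|n IH]; first by rewrite ln1 mul0r subr0.
rewrite factS natrM lnM ?posrE ?ltr0n ?fact_gt0//.
have [n0|n0] := posnP n; first by rewrite n0 ln1; lra.
have n0R : 0 < n%:R :> R by rewrite ltr0n.
have := @ln_succ_le R n n0.
rewrite -(ler_pM2l n0R) divff ?gt_eqF// -natr1; lra.
Qed.

(** The terms are dominated by the differences of [(log m + 2) / m], so the sum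
telescopes. *)
Lemma sum_ln_le (R : realType) n :
  \sum_(1 <= m < n) ln m.+1%:R / (m.+1%:R * m%:R) <= 2 :> R.
Proof.
case: n => [|n]; first by rewrite big_geq.
(* The telescoping sum starts at [(log 1 + 2) / 1 = 2]. *)
suff H : \sum_(1 <= m < n.+1) ln m.+1%:R / (m.+1%:R * m%:R)
    + n.+1%:R^-1 * (ln n.+1%:R + 2) <= 2 :> R.
  apply: le_trans H; rewrite lerDl mulr_ge0 ?addr_ge0 ?ln_ge0 ?ler1n//.
elim: n => [|n IH]; first by rewrite big_geq// ln1 invr1; lra.
rewrite big_nat_recr//=; apply: le_trans IH; rewrite -addrA lerD2l.
have n0R : 0 < n.+1%:R :> R by rewrite ltr0n.
have n1R : 0 < n.+2%:R :> R by rewrite ltr0n.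
have := ln_succ_le R n.+1 isT.
rewrite -[n.+2%:R]natr1 in n1R *.
move: (ln (n.+1%:R + 1)) (ln n.+1%:R) n0R n1R => u v.
have : 1 <= n.+1%:R :> R by rewrite ler1n.
move: n.+1%:R => m m1 m0 m2 H.
rewrite (_ : _ + _ = (u + m * (u + 2)) / ((m + 1) * m)); last by field; rewrite !gt_eqF.
rewrite (_ : m^-1 * _ = (v + 2) * (m + 1) / ((m + 1) * m)); last by field; rewrite !gt_eqF.
rewrite ler_pM2r ?invr_gt0 ?mulr_gt0//.
have H2 : m * (u - v) <= 1 by rewrite mulrC -ler_pdivlMr// mul1r.
have H3 : m^-1 <= 1 by rewrite invf_le1.
lra.
Qed.

Lemma sum_ln_primes_le (R : realType) n :
  \sum_(0 <= p < n | prime p) ln p%:R / (p%:R * (p%:R - 1)) <= 2 :> R.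
Proof.
case: n => [|n]; first by rewrite big_geq.
apply: le_trans (sum_ln_le R n); rewrite big_mkcond big_ltn//= add0r.
case: n => [|n]; first by rewrite !big_geq.
rewrite big_ltn//= add0r big_add1/=; apply: ler_sum_nat => m /andP[m1 _].
rewrite -[m.+1%:R]natr1 addrK; case: ifP => // _.
by rewrite natr1 mulr_ge0 ?invr_ge0 ?mulr_ge0 ?ln_ge0 ?ler1n.
Qed.

Lemma ln_prod_primes (R : realType) n :
  ln (\prod_(0 <= p < n | prime p) p)%N%:R = \sum_(0 <= p < n | prime p) ln p%:R :> R.
Proof.
by rewrite natr_prod ln_prod// => p pp; rewrite ltr0n prime_gt0.
Qed.

Definition mertens_sum (R : realType) n : R :=
  \sum_(0 <= p < n.+1 | prime p) ln p%:R / p%:R.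

Lemma theta_le (R : realType) k :
  \sum_(0 <= p < (2 ^ k).+1 | prime p) ln p%:R <= 2 * (2 ^ k)%:R :> R.
Proof.
have P0 : (0 < \prod_(0 <= p < (2 ^ k).+1 | prime p) p)%N.
  by apply: prodn_cond_gt0 => p; exact: prime_gt0.
rewrite -ln_prod_primes.
apply: le_trans (_ : ln (4 ^ (2 ^ k))%N%:R <= _).
  by rewrite ler_ln ?posrE ?ltr0n ?expn_gt0// ler_nat chebyshev_upper.
rewrite (_ : (4 = 2 ^ 2)%N)// -expnM natrX lnXn// -[_ *+ (2 * _)]mulr_natr natrM mulrA.
rewrite ler_wpM2r//; have [_] := ln2_bounds R; lra.
Qed.

(** Compares [log n! = n log n + O(n)] with [sum_p v_p(n!) log p] for [n = 2^k].
Since [n/p - 1 <= v_p(n!) <= n/(p-1)], the two errors are Chebyshev's [O(n)]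
and [n] times the convergent sum of [log p / (p (p-1))]. *)
Lemma mertens_first (R : realType) k :
  `| mertens_sum R (2 ^ k) - k%:R * ln 2 | <= 3.
Proof.
set n := (2 ^ k)%N; have n0 : 0 < n%:R :> R by rewrite ltr0n expn_gt0.
have lnn : ln n%:R = k%:R * ln 2 :> R by rewrite natrX lnXn// mulr_natl.
have le := ln_fact_le R n; have ge := ln_fact_ge R n.
have primes0 : forall p, prime p -> 0 < p%:R :> R /\ 0 <= ln p%:R :> R.
  by move=> p pp; rewrite ltr0n prime_gt0// ln_ge0// ler1n prime_gt0.
have lo : n%:R * mertens_sum R n - 2 * n%:R <= ln (n`!%:R : R).
  rewrite lerBlDr ln_fact_primes; apply: le_trans (lerD (lexx _) (theta_le R k)).
  rewrite -big_split/= mulr_sumr; apply: ler_sum => p pp.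
  have [p0 lp0] := primes0 p pp.
  have := ler_wpM2r lp0 (logn_fact_lower R p n pp); rewrite mulrBl mul1r.
  by rewrite mulrA mulrAC; lra.
(* [n / (p - 1) = n / p + n / (p * (p - 1))]. *)
have hi : ln (n`!%:R : R) <= n%:R * (mertens_sum R n + 2).
  apply: le_trans (_ : n%:R * (mertens_sum R n +
     \sum_(0 <= p < n.+1 | prime p) ln p%:R / (p%:R * (p%:R - 1))) <= _); last first.
    by rewrite ler_pM2l// lerD2l sum_ln_primes_le.
  rewrite ln_fact_primes -big_split/= mulr_sumr; apply: ler_sum => p pp.
  have [p0 lp0] := primes0 p pp.
  have p1 : 0 < p%:R - 1 :> R by rewrite subr_gt0 ltr1n prime_gt1.
  rewrite (_ : _ + _ = ln p%:R / (p%:R - 1)); last by field; rewrite !gt_eqF.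
  rewrite mulrCA mulrC ler_wpM2l// ler_pdivlMr//.
  have := logn_fact_upper p n pp.
  by rewrite -(ler_nat R) natrM -subn1 natrB ?prime_gt0.
rewrite lnn in le ge.
rewrite ler_norml lerBlDr lerBrDr; apply/andP; split.
  rewrite -(ler_pM2l n0); lra.
by rewrite -(ler_pM2l n0); lra.
Qed.

(** * Sums over dyadic blocks of primes *)

Lemma ge0_series_cvg (R : realType) (u : R^nat) (M : R) :
  (forall n, 0 <= u n) -> (forall n, series u n <= M) -> cvgn (series u).
Proof.
move=> u0 uM; apply: nondecreasing_is_cvgn; first exact: nondecreasing_series.
by exists M => _ [n _ <-].
Qed.

(** Dirichlet's test for the weights [1/(k+1)]: summation by parts leaves a
bounded sequence times [1/(k+1)] and an absolutely convergent series. *)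
Lemma bounded_series_harmonic_cvg (R : realType) (w : R^nat) (B : R) :
  (forall n, `|series w n| <= B) -> cvgn (series (fun k => w k / k.+1%:R)).
Proof.
move=> wB; have B0 : 0 <= B by apply: le_trans (wB 0%N).
pose d k : R := k.+1%:R^-1 - k.+2%:R^-1.
have d0 k : 0 <= d k.
  by rewrite subr_ge0 lef_pV2 ?posrE ?ltr0n// ler_nat.
have -> : series (fun k => w k / k.+1%:R) =
    (fun n => series w n * harmonic n) \+ series (fun k => series w k.+1 * d k).
  apply/funext => n; change (series (fun k => w k / k.+1%:R) n =
    series w n * harmonic n + series (fun k => series w k.+1 * d k) n).
  elim: n => [|n IH]; first by rewrite !seriesEnat /= !big_geq// mul0r addr0.
  rewrite !seriesSr IH /d /harmonic; rewrite ?[mk_sequence _ _]/=; ring.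
apply: is_cvgD.
  apply: cvgP (0 : R) _; apply/cvgr0Pnorm_le => e e0; near=> n.
  rewrite normrM (le_trans (ler_pM _ _ (wB n) (lexx _)))//.
  rewrite ger0_norm ?harmonic_ge0//.
  apply: le_trans (_ : (B + 1) * harmonic n <= _); first by rewrite ler_wpM2r ?harmonic_ge0// lerDl.
  rewrite mulrC -ler_pdivlMr; last lra.
  near: n; apply: (@cvgr_le R _ \oo _ _ 0 (@cvg_harmonic R)).
  by rewrite divr_gt0//; lra.
apply: normed_cvg; apply: (@ge0_series_cvg _ _ B) => n; first exact: normr_ge0.
suff H : series (fun k => `|series w k.+1 * d k|) n <= B * (1 - n.+1%:R^-1).
  by apply: (le_trans H); rewrite ler_piMr// gerBl invr_ge0.
elim: n => [|n IH]; first by rewrite seriesEnat/= big_geq// invr1 subrr mulr0.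
rewrite seriesSr; apply: (le_trans (lerD IH (lexx _))).
rewrite normrM (ger0_norm (d0 n)).
apply: le_trans (lerD (lexx _) (ler_wpM2r (d0 n) (wB n.+1))) _.
by rewrite le_eqVlt; apply/orP; left; apply/eqP; rewrite /d; ring.
Unshelve. all: by end_near. Qed.

Lemma sum_inv_sqr_le (R : realType) n :
  series (fun k : nat => (k.+1%:R ^+ 2)^-1) n <= 2 :> R.
Proof.
suff H : series (fun k : nat => (k.+1%:R ^+ 2)^-1) n <= 2 * (1 - n.+1%:R^-1) :> R.
  by apply: (le_trans H); rewrite ler_piMr// gerBl invr_ge0.
elim: n => [|n IH]; first by rewrite seriesEnat/= big_geq// invr1 subrr mulr0.
rewrite seriesSr; apply: (le_trans (lerD IH (lexx _))).
have : 1 <= n.+1%:R :> R by rewrite ler1n.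
rewrite -[n.+2%:R]natr1; move: n.+1%:R => m m1.
rewrite -subr_ge0 (_ : _ - _ = (m - 1) / (m ^+ 2 * (m + 1))).
  by rewrite divr_ge0 ?subr_ge0// mulr_ge0 ?sqr_ge0//; lra.
by field; apply/andP; split; rewrite gt_eqF//; lra.
Qed.

Definition prime_log (R : realType) (p : nat) : R := - ln (1 - p%:R^-1).

(** The blocks start at [k = 0] with the single prime 2; the primes of block [k]
have [log p / log 2] in [(k, k+1]]. *)
Definition block {R : realType} (F : nat -> R) (k : nat) : R :=
  \sum_((2 ^ k).+1 <= p < (2 ^ k.+1).+1 | prime p) F p.

Lemma series_block (R : realType) (F : nat -> R) K :
  series (block F) K = \sum_(0 <= p < (2 ^ K).+1 | prime p) F p.
Proof.
elim: K => [|K IH].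
  by rewrite seriesEnat/= expn0 [LHS]big_geq// unlock.
rewrite seriesSr IH [RHS](@big_cat_nat _ _ _ (2 ^ K).+1)//=.
by rewrite ltnS leq_exp2l.
Qed.

Lemma ler_block (R : realType) (F G : nat -> R) k :
  (forall p, prime p -> (2 ^ k < p <= 2 ^ k.+1)%N -> F p <= G p) ->
  block F k <= block G k.
Proof.
move=> FG; rewrite /block big_seq_cond [leRHS]big_seq_cond; apply: ler_sum => p.
by rewrite mem_index_iota ltnS => /andP[? ?]; exact: FG.
Qed.

Lemma ln_block (R : realType) k p : (2 ^ k < p <= 2 ^ k.+1)%N ->
  k%:R * ln 2 <= ln (p%:R : R) <= k.+1%:R * ln 2.
Proof.
move=> /andP[kp pk]; have p0 : (0 < p)%N by apply: leq_trans kp.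
have H j : ln (2 ^ j)%:R = j%:R * ln 2 :> R by rewrite natrX lnXn// mulr_natl.
by rewrite -!H !ler_ln ?posrE ?ltr0n ?expn_gt0// !ler_nat pk ltnW.
Qed.

Lemma prime_log_bounds (R : realType) p : (1 < p)%N ->
  p%:R^-1 <= prime_log R p <= (p%:R - 1)^-1.
Proof.
move=> p1; have p1R : 1 < p%:R :> R by rewrite ltr1n.
have p0 : 0 < p%:R :> R by lra.
have i1 : p%:R^-1 < 1 :> R by rewrite invf_lt1.
apply/andP; split; rewrite /prime_log.
  by have := @le_ln1Dx R (- p%:R^-1); rewrite ltrN2 => /(_ i1); lra.
rewrite -lnV ?posrE ?subr_gt0// (_ : _^-1 = 1 + (p%:R - 1)^-1).
  by apply: le_ln1Dx; rewrite (@lt_trans _ _ 0)// ?invr_gt0 ?oppr_lt0// subr_gt0.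
field; rewrite !gt_eqF//= ?subr_gt0//.
Qed.

Lemma mertens_first_series (R : realType) n :
  `|series (fun k => block (fun p => ln p%:R / p%:R) k / ln 2 - 1) n| <= 6 :> R.
Proof.
have [l1 l2] := ln2_bounds R; have l0 : 0 < ln 2 :> R by lra.
have e := series_block R (fun p => ln p%:R / p%:R) n.
rewrite seriesEnat/= in e.
rewrite seriesEnat /= sumrB -mulr_suml e -/(mertens_sum R _) sumr_const_nat subn0.
rewrite (_ : _ - _ = (mertens_sum R (2 ^ n) - n%:R * ln 2) / ln 2); last first.
  by field; rewrite gt_eqF.
rewrite normrM normfV (gtr0_norm l0) ler_pdivrMr//.
by apply: le_trans (mertens_first R n) _; lra.
Qed.

(** The difference [block prime_log k - 1/(k+1)] is split in two. The part
[(a_k / log 2 - 1) / (k+1)], where [a_k] is the block sum of [log p / p],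
converges by Dirichlet's test. The rest is a block sum of
[prime_log p - log p / ((k+1) p log 2)], which is nonnegative and summable since
[log p = (k+1) log 2 + O(1)] on the block and
[prime_log p = 1/p + O(1 / (p (p-1)))]. *)
Lemma block_prime_log_cvg (R : realType) :
  cvgn (series (fun k => block (@prime_log R) k - k.+1%:R^-1)).
Proof.
have [l1 l2] := ln2_bounds R; have l0 : 0 < ln 2 :> R by lra.
pose a : R^nat := block (fun p => ln p%:R / p%:R).
pose w k : R := a k / ln 2 - 1.
pose d k : R := block (fun p => prime_log R p - ln p%:R / (p%:R * (k.+1%:R * ln 2))) k.
have wB n : `|series w n| <= 6 by exact: mertens_first_series.
have -> : series (fun k => block (@prime_log R) k - k.+1%:R^-1) =
    series d + series (fun k => w k / k.+1%:R).
  rewrite -seriesD; congr (series _); apply/funext => k.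
  rewrite -[RHS]/(d k + w k / k.+1%:R) /d /block sumrB.
  rewrite (_ : \sum_(_ <= p < _ | _) _ / (_ * _) = a k / (k.+1%:R * ln 2)).
    by rewrite /w; field; rewrite nat1r pnatr_eq0 (gt_eqF l0).
  rewrite /a /block mulr_suml; apply: eq_bigr => p pp.
  by rewrite invfM mulrA.
apply: is_cvgD; last exact: bounded_series_harmonic_cvg wB.
pose t p : R := ln p%:R / (p%:R * (p%:R - 1)).
(* Consecutive partial sums are bounded by 6, so [a k / ln 2 - 1 <= 12]. *)
have a13 k : a k / ln 2 <= 13.
  have := wB k.+1; have := wB k; rewrite seriesSr !ler_norml /w.
  move: (series _ _) => s /andP[? ?] /andP[? ?]; lra.
(* The factors 2 come from [1 <= 2 * ln 2] and from
   [2 * ln p >= (k + 1) * ln 2], which holds also at [k = 0]. *)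
have key k p : prime p -> (2 ^ k < p <= 2 ^ k.+1)%N ->
    0 <= prime_log R p - ln p%:R / (p%:R * (k.+1%:R * ln 2)) <=
    2 * t p + (ln p%:R / p%:R) * (2 / ln 2 * (k.+1%:R ^+ 2)^-1).
  move=> pp kp; have p1 := prime_gt1 pp.
  have /andP[L1 L2] := prime_log_bounds R p p1.
  have /andP[ln1 ln2] := ln_block R k p kp.
  have p2 : 2 <= p%:R :> R by rewrite ler_nat.
  have p0 : 0 < p%:R :> R by lra.
  have lnp : ln 2 <= ln p%:R :> R by rewrite ler_ln ?posrE.
  have k0 : 0 < k.+1%:R :> R by rewrite ltr0n.
  apply/andP; split.
    rewrite subr_ge0; apply: le_trans L1.
    rewrite invfM mulrCA; apply: ler_piMr; first by rewrite invr_ge0 ltW.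
    by rewrite ler_pdivrMr ?mulr_gt0// mul1r.
  have -> : t p = ln p%:R * ((p%:R - 1)^-1 - p%:R^-1).
    by rewrite /t; field; rewrite !gt_eqF//; lra.
  have i0 : 0 <= (p%:R - 1)^-1 - p%:R^-1 :> R.
    by rewrite subr_ge0 lef_pV2 ?posrE//; lra.
  have H1 : (p%:R - 1)^-1 - p%:R^-1 <= 2 * (ln p%:R * ((p%:R - 1)^-1 - p%:R^-1)) :> R.
    by rewrite mulrA ler_peMl//; lra.
  suff H2 : p%:R^-1 - ln p%:R / (p%:R * (k.+1%:R * ln 2)) <=
     (ln p%:R / p%:R) * (2 / ln 2 * (k.+1%:R ^+ 2)^-1) :> R.
    by apply: le_trans (lerD H1 H2); rewrite addrA subrK lerD2r.
  have -> : p%:R^-1 - ln p%:R / (p%:R * (k.+1%:R * ln 2)) =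
     (p%:R * k.+1%:R ^+ 2 * ln 2)^-1 * (k.+1%:R * (k.+1%:R * ln 2 - ln p%:R)) :> R.
    by field; rewrite ?nat1r !gt_eqF//.
  have -> : (ln p%:R / p%:R) * (2 / ln 2 * (k.+1%:R ^+ 2)^-1) =
    (p%:R * k.+1%:R ^+ 2 * ln 2)^-1 * (2 * ln p%:R) :> R.
    by field; rewrite ?nat1r !gt_eqF//.
  apply: ler_wpM2l.
    by rewrite invr_ge0 mulr_ge0 ?(ltW l0)// mulr_ge0 ?sqr_ge0 ?(ltW p0).
  have : k.+1%:R * (k.+1%:R * ln 2 - ln p%:R) <= k.+1%:R * ln 2 :> R.
    by rewrite ler_pM2l//; move: ln1; rewrite -[k.+1%:R]natr1; lra.
  move=> H; apply: (le_trans H); move: ln1 lnp; rewrite -[k.+1%:R]natr1 mulrDl mul1r.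
  by move: (ln 2) (ln p%:R) (k%:R * _) => u v uu; lra.
apply: (@ge0_series_cvg _ _ (4 + 26 * 2)) => n.
  rewrite /d /block big_seq_cond; apply: sumr_ge0 => p.
  by rewrite mem_index_iota ltnS => /andP[kp pp]; have /andP[] := key n p pp kp.
apply: (@le_trans _ _ (2 * series (block t) n + 26 * series (fun k => (k.+1%:R ^+ 2)^-1) n)).
  rewrite !seriesEnat/= !mulr_sumr -big_split/=; apply: ler_sum => k _.
  apply: (@le_trans _ _ (2 * block t k + a k * (2 / ln 2 * (k.+1%:R ^+ 2)^-1))).
    rewrite /d /a {2 3}/block mulr_sumr mulr_suml -big_split/=.
    by apply: ler_block => p pp kp; have /andP[] := key k p pp kp.
  rewrite lerD2l mulrA ler_wpM2r ?invr_ge0 ?sqr_ge0//.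
  have -> : a k * (2 / ln 2) = 2 * (a k / ln 2) by rewrite mulrCA.
  by have := a13 k; move: (a k / ln 2) => v; lra.
have H1 : series (block t) n <= 2 by rewrite series_block; exact: sum_ln_primes_le.
have H2 := sum_inv_sqr_le R n.
apply: lerD; last by rewrite ler_pM2l.
by rewrite (_ : 4 = 2 * 2) ?ler_pM2l// -natrM.
Qed.

(** * Abel's theorem and the constants log(1 - z) and gamma *)

Lemma sum_powers (R : realType) (z : R) K :
  (1 - z) * \sum_(0 <= k < K) z ^+ k = 1 - z ^+ K.
Proof.
elim: K => [|K IH]; first by rewrite big_geq// mulr0 subrr.
by rewrite big_nat_recr//= mulrDr IH exprS; ring.
Qed.

(** Abel's theorem, stated for partial sums: the bound holds uniformly in [K],
so that the limit in [K] can be taken after [z] is chosen. With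
[e_k = series c k - C], summation by parts gives
[sum_(k < K) c_k z^(k+1) - C = e_K z^K + (1 - z) sum_(k < K) e_k z^k]. *)
Lemma abel_uniform (R : realType) (c : R^nat) (C : R) :
  series c @ \oo --> C -> forall eps : R, 0 < eps ->
  exists N, exists2 eta, 0 < eta & forall z, 0 < z -> 1 - eta < z -> z < 1 ->
    forall K, (N <= K)%N ->
    `|\sum_(0 <= k < K) c k * z ^+ k.+1 - C| <= eps.
Proof.
move=> cC eps e0.
pose e k := series c k - C.
(* Summation by parts; the term [e 0 = - C] cancels against the limit. *)
have idt z K : \sum_(0 <= k < K) c k * z ^+ k.+1 - C =
    e K * z ^+ K + (1 - z) * \sum_(0 <= k < K) e k * z ^+ k.
  elim: K => [|K IH].
    by rewrite !big_geq// /e seriesEnat/= big_geq// expr0; ring.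
  rewrite !big_nat_recr//= mulrDr addrAC IH /e seriesSr !exprS; ring.
have [B [Bgt0 eB]] : exists B : R, 0 < B /\ forall k, `|e k| <= B.
  have [M [_ HM]] : bounded_fun (series c).
    by apply: cvg_seq_bounded; apply/cvg_ex; exists C.
  have M1 : M < `|M| + 1 by rewrite ltr_pwDr// ler_norm.
  exists (`|M| + 1 + `|C| + 1); split; first by have := normr_ge0 M; have := normr_ge0 C; lra.
  move=> k; apply: (le_trans (ler_normB _ _)).
  have H : `|series c k| <= `|M| + 1 by exact: HM.
  by move: H (normr_ge0 M); lra.
have e3 : 0 < eps / 3 by lra.
have /cvgrPdist_le/(_ _ e3)[N _ HN] := cC.
have HN' k : (N <= k)%N -> `|e k| <= eps / 3.
  by move=> Nk; have := HN k Nk; rewrite distrC.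
have NB0 : 0 < N%:R * B + 1 by rewrite ltr_wpDl// mulr_ge0// ltW.
exists N, (eps / 3 / (N%:R * B + 1)) => [|z z0 z1 z2 K NK]; first by rewrite divr_gt0.
have zk k : 0 <= z ^+ k <= 1 by rewrite exprn_ge0 ?exprn_ile1 ?ltW.
have z1' : 0 < 1 - z by lra.
rewrite idt; apply: (le_trans (ler_normD _ _)).
have H1 : `|e K * z ^+ K| <= eps / 3.
  have /andP[a b] := zk K.
  by rewrite normrM (ger0_norm a); apply: le_trans (HN' K NK); rewrite ler_piMr.
suff H2 : `|(1 - z) * \sum_(0 <= k < K) e k * z ^+ k| <= eps / 3 + eps / 3.
  by have := lerD H1 H2; lra.
rewrite normrM (gtr0_norm z1').
apply: (@le_trans _ _ ((1 - z) * (N%:R * B + eps / 3 * \sum_(0 <= k < K) z ^+ k))).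
  rewrite ler_pM2l//; apply: (le_trans (ler_norm_sum _ _ _)).
  rewrite (@big_cat_nat _ _ _ N)//= lerD//.
    rewrite mulr_natl -[N in _ *+ N]subn0 -sumr_const_nat; apply: ler_sum => k _.
    have /andP[a b] := zk k.
    by rewrite normrM (ger0_norm a); apply: le_trans (eB k); rewrite ler_piMr.
  rewrite [X in _ <= _ * X](@big_cat_nat _ _ _ N)//= mulrDr.
  rewrite -[leLHS]add0r lerD//.
    by rewrite mulr_ge0 ?(ltW e3)//; apply: sumr_ge0 => k _; have /andP[] := zk k.
  rewrite mulr_sumr; apply: ler_sum_nat => k /andP[Nk _].
  have /andP[a b] := zk k.
  by rewrite normrM (ger0_norm a) ler_wpM2r// HN'.
rewrite mulrDr (mulrCA (1 - z) (eps / 3)) sum_powers.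
have /andP[a b] := zk K.
have H3 : (1 - z) * (N%:R * B) <= eps / 3.
  apply: (@le_trans _ _ ((1 - z) * (N%:R * B + 1))); first by rewrite ler_pM2l// lerDl.
  by rewrite -ler_pdivlMr//; lra.
rewrite lerD// ler_piMr ?(ltW e3)//; lra.
Qed.

(** The derivative of the sum is a geometric sum, so the difference with
[-log(1 - t)] has a closed derivative. *)
Lemma is_derive_ln_series (R : realType) K (t : R) : t < 1 ->
  is_derive t 1 (fun t => - ln (1 - t) - \sum_(0 <= k < K) t ^+ k.+1 / k.+1%:R)
    (t ^+ K / (1 - t)).
Proof.
move=> t1; have t10 : 1 - t != 0 by rewrite gt_eqF// subr_gt0.
elim: K => [|K IH].
  rewrite (_ : (fun _ => _) = - (@ln R \o (fun t => 1 - t))); last first.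
    by apply/funext => s; rewrite big_geq// subr0.
  apply: is_derive_eq.
    apply: is_deriveN; apply: is_derive1_comp.
      by apply: is_derive1_ln; rewrite subr_gt0.
  by rewrite expr0; field.
rewrite (_ : (fun _ => _) = (fun t => - ln (1 - t) - \sum_(0 <= k < K) t ^+ k.+1 / k.+1%:R) -
   (K.+1%:R^-1 *: (id : R -> R) ^+ K.+1)); last first.
  apply/funext => s; rewrite big_nat_recr//= opprD addrA.
  by congr (_ - _); rewrite -[RHS]/(K.+1%:R^-1 * (id ^+ K.+1) s) fctE mulrC.
apply: is_derive_eq.
rewrite /= exprS scaler1 -[_ *: _]/(K.+1%:R^-1 * _) mulKf ?pnatr_eq0//.
by field.
Qed.

(** Mean value theorem on [0, z]: the error is at most [z^K / (1 - z)]. *)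
Lemma ln_series (R : realType) (z : R) : 0 < z -> z < 1 ->
  \sum_(0 <= k < K) z ^+ k.+1 / k.+1%:R @[K --> \oo] --> - ln (1 - z).
Proof.
move=> z0 z1.
have bnd K : 0 <= - ln (1 - z) - \sum_(0 <= k < K) z ^+ k.+1 / k.+1%:R <= (1 - z)^-1 * z ^+ K.
  pose f (t : R) := - ln (1 - t) - \sum_(0 <= k < K) t ^+ k.+1 / k.+1%:R.
  pose df (t : R) := t ^+ K / (1 - t).
  have Df (t : R) : t < 1 -> is_derive t 1 f (df t).
    exact: is_derive_ln_series.
  have [c c01] : exists2 c, c \in `]0, z[%R & f z - f 0 = df c * (z - 0).
    apply: MVT => //.
      by move=> t; rewrite in_itv/= => /andP[_ tz]; apply: Df; lra.
    apply: derivable_within_continuous => t; rewrite in_itv/= => /andP[_ tz].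
    by apply: ex_derive; apply: Df; lra.
  move: c01; rewrite in_itv/= => /andP[c0 cz].
  rewrite {2}/f subr0 ln1 oppr0 big1 ?subr0 => [|k _]; last by rewrite expr0n mul0r.
  rewrite -/(f z) => ->; rewrite /df addr0.
  have i0 : 0 < (1 - c)^-1 by rewrite invr_gt0; lra.
  have iz : (1 - c)^-1 <= (1 - z)^-1 by rewrite lef_pV2 ?posrE; lra.
  have cK : 0 <= c ^+ K by rewrite exprn_ge0// ltW.
  have cz' : c ^+ K <= z ^+ K by rewrite lerXn2r ?nnegrE; lra.
  rewrite !mulr_ge0 ?(ltW i0) ?(ltW z0)//=.
  apply: (@le_trans _ _ (c ^+ K / (1 - c))); last first.
    by rewrite mulrC ler_pM// ltW.
  apply: ler_piMr; last exact: ltW.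
  by apply: mulr_ge0 => //; exact: ltW.
apply: (@squeeze_cvgr _ _ _ _ (fun K => - ln (1 - z) - (1 - z)^-1 * z ^+ K) (fun=> - ln (1 - z))).
- by near=> K; have := bnd K; lra.
- suff : (fun K => - ln (1 - z) - (1 - z)^-1 * z ^+ K) @ \oo -->
      - ln (1 - z) - (1 - z)^-1 * 0 by rewrite mulr0 subr0.
  apply: cvgB; first exact: cvg_cst.
  apply: cvgM; first exact: cvg_cst.
  by apply: cvg_expr; rewrite ger0_norm// ltW.
- exact: cvg_cst.
Unshelve. all: by end_near. Qed.

(** The constant is defined as the value of a limit operator; convergence
follows from monotonicity, after dropping the index 0 where [ln 0 = 0]. *)
Lemma euler_gamma_cvg (R : realType) :
  (\sum_(1 <= k < n.+1) k%:R^-1 - ln (n%:R : R)) @[n --> \oo] --> euler_gamma R.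
Proof.
rewrite /euler_gamma.
pose u n : R := \sum_(1 <= k < n.+1) k%:R^-1 - ln n%:R.
suff : cvgn u by [].
suff : cvgn (fun n => u n.+1) by move=> /cvg_ex[l ul]; apply/cvg_ex; exists l; rewrite -cvg_shiftS.
apply: nonincreasing_is_cvgn.
  apply/nonincreasing_seqP => n; rewrite /u [in leLHS]big_nat_recr//=.
  have : ln (1 - n.+2%:R^-1) <= - n.+2%:R^-1 :> R.
    by apply: le_ln1Dx; rewrite ltrN2 invf_lt1// ltr1n.
  have -> : 1 - n.+2%:R^-1 = n.+1%:R / n.+2%:R :> R.
    by rewrite -[n.+2%:R]natr1; field; rewrite nat1r natr1 pnatr_eq0.
  rewrite ln_div ?posrE//; by move: (ln n.+1%:R) (ln n.+2%:R) (n.+2%:R^-1) (\sum_(1 <= k < n.+2) _) => *; lra.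
exists 0 => _ [n _ <-]; rewrite /u subr_ge0.
apply: (@le_trans _ _ (ln n.+2%:R)); first by rewrite ler_ln ?posrE// ler_nat.
elim: n => [|n IH].
  rewrite big_nat1 invr1; have [_ h] := ln2_bounds R; exact: h.
rewrite big_nat_recr//=; have := ln_succ_le R n.+2 isT; move: IH.
by move: (ln n.+2%:R) (ln n.+3%:R) (n.+2%:R^-1) (\sum_(1 <= k < n.+2) _) => *; lra.
Qed.

(** * The Euler product of the zeta function *)

(** The term [n^(-(1+d))] of the zeta series. Its value at [n = 0] is 0, which makes
it completely multiplicative on all natural numbers. *)
Definition zeta_term {R : realType} (d : R) (n : nat) : R :=
  n%:R^-1 * expR (- d * ln n%:R).

Lemma zeta_term_ge0 (R : realType) (d : R) n : 0 <= zeta_term d n.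
Proof. by rewrite mulr_ge0 ?expR_ge0. Qed.

Lemma zeta_term1 (R : realType) (d : R) : zeta_term d 1 = 1.
Proof. by rewrite /zeta_term ln1 mulr0 expR0 invr1 mulr1. Qed.

Lemma zeta_termM (R : realType) (d : R) m n :
  zeta_term d (m * n) = zeta_term d m * zeta_term d n.
Proof.
rewrite /zeta_term; have [->|m0] := posnP m; first by rewrite mul0n !invr0 !mul0r.
have [->|n0] := posnP n; first by rewrite muln0 !invr0 !mul0r mulr0.
rewrite natrM lnM ?posrE ?ltr0n// mulrDr expRD invfM; ring.
Qed.

(** The integral comparison for [n^(-1-d)], in the form of the two estimates
[1 - y <= e^(-y)] and [1 + y <= e^y] applied to [y = d log((n+1)/n)]. *)
Lemma zeta_term_telescope (R : realType) (d : R) n : (0 < n)%N -> 0 < d ->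
  d * zeta_term d n.+1 <= expR (- d * ln n%:R) - expR (- d * ln n.+1%:R) <= d * zeta_term d n.
Proof.
move=> n0 d0; have n0R : 0 < n%:R :> R by rewrite ltr0n.
rewrite /zeta_term; set e1 := expR _; set e := expR _.
have l1 := ln_succ_le R n n0.
have l2 : n.+1%:R^-1 <= ln n.+1%:R - ln n%:R :> R.
  have : ln (1 - n.+1%:R^-1) <= - n.+1%:R^-1 :> R.
    by apply: le_ln1Dx; rewrite ltrN2 invf_lt1// ltr1n.
  have -> : 1 - n.+1%:R^-1 = n%:R / n.+1%:R :> R.
    by rewrite -[n.+1%:R]natr1; field; rewrite natr1 pnatr_eq0.
  rewrite ln_div ?posrE//; move: (ln n%:R) (ln n.+1%:R) (n.+1%:R^-1) => *; lra.
have E : e1 = e * expR (- (d * (ln n.+1%:R - ln n%:R))).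
  by rewrite /e1 /e -expRD; congr expR; move: (ln n%:R) (ln n.+1%:R) => u v; ring.
have E1 : e = e1 * expR (d * (ln n.+1%:R - ln n%:R)).
  by rewrite /e /e1 -expRD; congr expR; move: (ln n%:R) (ln n.+1%:R) => u v; ring.
apply/andP; split.
  have h := expR_ge1Dx (d * (ln n.+1%:R - ln n%:R)).
  have h2 : d * n.+1%:R^-1 <= d * (ln n.+1%:R - ln n%:R) by rewrite ler_pM2l.
  have : e1 * (1 + d * n.+1%:R^-1) <= e.
    rewrite E1 ler_wpM2l ?expR_ge0//; apply: le_trans h; by rewrite lerD2l.
  by move: (n.+1%:R^-1) => v; lra.
have h := expR_ge1Dx (- (d * (ln n.+1%:R - ln n%:R))).
have h2 : d * (ln n.+1%:R - ln n%:R) <= d * n%:R^-1 by rewrite ler_pM2l.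
have : e * (1 - d * n%:R^-1) <= e1.
  rewrite E ler_wpM2l ?expR_ge0//; apply: le_trans h; by rewrite lerD2l lerN2.
by move: (n%:R^-1) => v; lra.
Qed.

Lemma zeta_cvg (R : realType) (d : R) : 0 < d ->
  exists2 z : R, 1 / d <= z <= 1 + 1 / d &
    \sum_(1 <= n < X.+1) zeta_term d n @[X --> \oo] --> z.
Proof.
move=> d0; pose S X := \sum_(1 <= n < X.+1) zeta_term d n.
have S_upper X : S X <= 1 + 1 / d.
  suff H : S X.+1 <= 1 + (1 - expR (- d * ln X.+1%:R)) / d.
    apply: (@le_trans _ _ (S X.+1)); first by rewrite /S [leRHS]big_nat_recr//= lerDl zeta_term_ge0.
    apply: (le_trans H); rewrite lerD2l ler_pM2r ?invr_gt0// gerBl expR_ge0//.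
  elim: X => [|X IH].
    by rewrite /S big_nat1 zeta_term1 ln1 mulr0 expR0 subrr mul0r addr0.
  rewrite /S big_nat_recr//=; apply: (le_trans (lerD IH (lexx _))).
  have /andP[h _] := zeta_term_telescope R d X.+1 isT d0.
  rewrite -addrA lerD2l -lerBrDl -mulrBl ler_pdivlMr// mulrC.
  by apply: (le_trans h); lra.
have S_lower X : (1 - expR (- d * ln X.+1%:R)) / d <= S X.
  elim: X => [|X IH]; first by rewrite /S big_geq// ln1 mulr0 expR0 subrr mul0r.
  rewrite /S big_nat_recr//=; apply: le_trans (lerD IH (lexx _)).
  have /andP[_ h] := zeta_term_telescope R d X.+1 isT d0.
  rewrite -lerBlDl -mulrBl ler_pdivrMr// [leRHS]mulrC.
  by apply: le_trans h; lra.
have S_cvg : cvgn S.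
  apply: nondecreasing_is_cvgn; last by exists (1 + 1 / d) => _ [n _ <-].
  by apply/nondecreasing_seqP => n; rewrite /S [leRHS]big_nat_recr//= lerDl zeta_term_ge0.
exists (limn S) => //; apply/andP; split; last first.
  by apply: limr_le => //; near=> n.
have e0 : (1 - expR (- d * ln X.+1%:R)) / d @[X --> \oo] --> (1 - 0) / d.
  apply: cvgM; last exact: cvg_cst; apply: cvgB; first exact: cvg_cst.
  apply/cvgr0Pnorm_lt => e e0; near=> X.
  rewrite ger0_norm ?expR_ge0// -[ltRHS]lnK ?posrE// ltr_expR.
  rewrite mulNr ltrNl -ltr_pdivrMl// -ltr_expR lnK ?posrE// -natr1 ltr_wpDr//.
  by near: X; exact: nbhs_infty_gtr.
rewrite subr0 in e0; rewrite -(cvg_lim _ e0)//.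
apply: ler_lim => //; first by apply: cvgP e0.
by near=> n.
Unshelve. all: by end_near. Qed.

Lemma sum_multiples (R : realType) (F : nat -> R) (Q : pred nat) p X : (0 < p)%N ->
  \sum_(1 <= n < X.+1 | (p %| n)%N && Q n) F n =
  \sum_(1 <= m < (X %/ p).+1 | Q (p * m)%N) F (p * m)%N.
Proof.
move=> p0; elim: X => [|X IH]; first by rewrite div0n !big_geq.
rewrite big_mkcond big_nat_recr//= -big_mkcond IH divnS//.
have [/dvdnP[k Xk]|] := boolP (p %| X.+1)%N; last by rewrite add0n addr0.
rewrite add1n [RHS]big_mkcond big_nat_recr//= -big_mkcond/=.
suff -> : (p * (X %/ p).+1 = X.+1)%N by [].
have : (X.+1 %/ p = (X %/ p).+1)%N by rewrite divnS// Xk dvdn_mull.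
by move=> <-; rewrite mulnC divnK// Xk dvdn_mull.
Qed.

Definition sifted (s : seq nat) (n : nat) := all (fun p => ~~ (p %| n)%N) s.

(** Sieving by one more prime [p] removes the multiples of [p]; these are [p m]
with [m] sifted by the previous primes, so their sum is [zeta_term d p] times the
previous partial sum at [X %/ p]. *)
Lemma sifted_zeta_cvg (R : realType) (d z : R) (s : seq nat) :
  \sum_(1 <= n < X.+1) zeta_term d n @[X --> \oo] --> z ->
  uniq s -> all prime s ->
  \sum_(1 <= n < X.+1 | sifted s n) zeta_term d n @[X --> \oo] -->
    z * \prod_(p <- s) (1 - zeta_term d p).
Proof.
move=> zcvg; elim: s => [_ _|p s IH /= /andP[ps us] /andP[pp ap]].
  by rewrite big_nil mulr1.
have {}IH := IH us ap; have p0 := prime_gt0 pp.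
rewrite big_cons mulrCA mulrBl mul1r.
have E X : \sum_(1 <= n < X.+1 | sifted (p :: s) n) zeta_term d n =
    \sum_(1 <= n < X.+1 | sifted s n) zeta_term d n -
    zeta_term d p * \sum_(1 <= n < (X %/ p).+1 | sifted s n) zeta_term d n.
  rewrite [X in _ = X - _](bigID (fun n => p %| n)%N)/=.
  have -> : \sum_(1 <= n < X.+1 | sifted s n && (p %| n)%N) zeta_term d n =
      zeta_term d p * \sum_(1 <= m < (X %/ p).+1 | sifted s m) zeta_term d m.
    under eq_bigl do rewrite andbC.
    rewrite sum_multiples// mulr_sumr.
    apply: eq_big => [m|m _]; last by rewrite zeta_termM.
    apply: eq_in_all => q qs; have pq := allP ap q qs.
    rewrite Euclid_dvdM// dvdn_prime2//.
    by case: eqP => [e|//]; move: ps; rewrite -e qs.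
  rewrite addrAC subrr add0r; apply: eq_bigl => n.
  by rewrite /sifted/= andbC.
under eq_fun do rewrite E.
apply: cvgB => //; apply: cvgM; first exact: cvg_cst.
apply: (@cvg_comp _ _ _ (fun X => X %/ p)%N (fun Y => \sum_(1 <= n < Y.+1 | sifted s n) zeta_term d n) _ \oo) => //.
apply/cvgnyPge => A; near=> X.
by rewrite leq_divRL//; near: X; exact: nbhs_infty_ge.
Unshelve. all: by end_near. Qed.

Lemma zeta_term_prime (R : realType) (d : R) p : 0 < d -> prime p ->
  0 < zeta_term d p < 1.
Proof.
move=> d0 pp; have p1 := prime_gt1 pp; have p0 := prime_gt0 pp.
rewrite mulr_gt0 ?expR_gt0 ?invr_gt0 ?ltr0n//= (@le_lt_trans _ _ (p%:R^-1))//.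
  by rewrite ler_piMr ?invr_ge0// expR_le1 mulNr oppr_le0 mulr_ge0 ?ltW// ln_gt0// ltr1n.
by rewrite invf_lt1 ?ltr1n ?ltr0n.
Qed.

(** After sieving by the primes up to [N], the term 1 survives, and nothing else up
to [N]. *)
Lemma sifted_zeta_bounds (R : realType) (d z : R) N : 0 < d -> (0 < N)%N ->
  let S X := \sum_(1 <= n < X.+1) zeta_term d n in
  S @ \oo --> z ->
  1 <= z * \prod_(0 <= p < N.+1 | prime p) (1 - zeta_term d p) <= 1 + (z - S N).
Proof.
move=> d0 N0 S zcvg; pose s := [seq p <- index_iota 0 N.+1 | prime p].
have T := sifted_zeta_cvg R d z s zcvg (filter_uniq _ (iota_uniq _ _)) (filter_all _ _).
rewrite big_filter in T; set P := _ * _ in T *.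
have s1 : sifted s 1.
  apply/allP => p; rewrite mem_filter => /andP[pp _].
  by rewrite dvdn1 neq_ltn prime_gt1 ?orbT.
rewrite -(cvg_lim _ T)//; apply/andP; split.
  apply: limr_ge; first by apply: cvgP T.
  near=> X; have X0 : (0 < X)%N by near: X; exact: nbhs_infty_gt.
  rewrite big_mkcond big_ltn//= s1 zeta_term1 lerDl; apply: sumr_ge0 => n _.
  by case: ifP => // _; exact: zeta_term_ge0.
have Scv : (fun X => 1 + (S X - S N)) @ \oo --> 1 + (z - S N).
  apply: cvgD; first exact: cvg_cst.
  by apply: cvgB => //; exact: cvg_cst.
rewrite -(cvg_lim _ Scv)//; apply: ler_lim; [exact: cvgP T|exact: cvgP Scv|].
near=> X; have NX : (N.+1 <= X)%N by near: X; exact: nbhs_infty_ge.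
have NX1 : (N.+1 <= X.+1)%N by apply: leq_trans NX _.
rewrite /S [in leRHS](@big_cat_nat _ _ _ N.+1)//= (addrAC _ _ (- _)) subrr add0r.
rewrite (@big_cat_nat _ _ _ N.+1)//= lerD//; last first.
  rewrite big_mkcond; apply: ler_sum => n _.
  by case: ifP => // _; exact: zeta_term_ge0.
rewrite big_mkcond big_ltn//= s1 zeta_term1 big_nat_cond big1 ?addr0// => n /andP[/andP[n1 nN] _].
case: ifP => // /allP/(_ (pdiv n)); rewrite pdiv_dvd mem_filter pdiv_prime//=.
by rewrite mem_index_iota/= (leq_ltn_trans (pdiv_leq (ltnW n1)) nN) => /(_ isT).
Unshelve. all: by end_near. Qed.

Lemma euler_product (R : realType) (d : R) : 0 < d ->
  exists2 z : R, 1 / d <= z <= 1 + 1 / d &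
    \sum_(0 <= p < N.+1 | prime p) - ln (1 - zeta_term d p) @[N --> \oo] --> ln z.
Proof.
move=> d0; have [z zb zcvg] := zeta_cvg R d d0; exists z => //.
have z0 : 0 < z.
  by have /andP[h _] := zb; apply: lt_le_trans h; rewrite divr_gt0.
pose P N := \prod_(0 <= p < N.+1 | prime p) (1 - zeta_term d p).
have P1 : (fun N => z * P N) @ \oo --> (1 : R).
  apply: (@squeeze_cvgr _ _ _ _ (fun=> 1) (fun N => 1 + (z - \sum_(1 <= n < N.+1) zeta_term d n))).
  - near=> N; apply: sifted_zeta_bounds => //.
    by near: N; exact: nbhs_infty_gt.
  - exact: cvg_cst.
  - suff : (fun N => 1 + (z - \sum_(1 <= n < N.+1) zeta_term d n)) @ \oo --> 1 + (z - z).
      by rewrite subrr addr0.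
    apply: cvgD; first exact: cvg_cst.
    by apply: cvgB => //; exact: cvg_cst.
have E N : \sum_(0 <= p < N.+1 | prime p) - ln (1 - zeta_term d p) = ln z - ln (z * P N).
  have P0 p : prime p -> 0 < 1 - zeta_term d p.
    by move=> pp; rewrite subr_gt0; have /andP[] := zeta_term_prime R d p d0 pp.
  rewrite lnM ?posrE ?prodr_gt0// ln_prod// sumrN opprD addrA subrr add0r //.
under eq_fun do rewrite E.
suff : (fun N => ln z - ln (z * P N)) @ \oo --> ln z - ln 1 by rewrite ln1 subr0.
apply: cvgB; first exact: cvg_cst.
by apply: (@cvg_comp _ _ _ (fun N => z * P N) (@ln R) _ _ _ P1); apply: continuous_ln.
Unshelve. all: by end_near. Qed.

(** Concavity of the logarithm between [1 - 1/p] and 1. *)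
Lemma prime_factor_upper (R : realType) (t : R) p : (1 < p)%N -> 0 <= t <= 1 ->
  - ln (1 - p%:R^-1 * t) <= t * prime_log R p.
Proof.
move=> p1 /andP[t0 t1]; rewrite /prime_log.
have i1 : p%:R^-1 < 1 :> R by rewrite invf_lt1 ?ltr1n// ltr0n ltnW.
have u0 : 0 < 1 - p%:R^-1 :> R by rewrite subr_gt0.
have := @concave_ln R (Itv01 t0 t1) _ _ u0 (@ltr01 R).
rewrite !convRE/= ln1 mulr0 addr0 mulr1 mulrN lerN2 => h.
by apply: (le_trans h); rewrite le_eqVlt; apply/orP; left; apply/eqP; congr ln; rewrite /unstable.onem; ring.
Qed.

(** The quotient of [1 - t/p] and [1 - 1/p] is [1 + (1 - t)/(p - 1)]; what remains
uses [1/p <= prime_log p]. *)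
Lemma prime_factor_lower (R : realType) (t : R) p : (1 < p)%N -> 0 <= t <= 1 ->
  t * prime_log R p <= - ln (1 - p%:R^-1 * t) + (1 - t) / (p%:R * (p%:R - 1)).
Proof.
move=> p1 /andP[t0 t1]; have /andP[L1 L2] := prime_log_bounds R p p1.
have p2 : 1 < p%:R :> R by rewrite ltr1n.
have i1 : p%:R^-1 < 1 :> R by rewrite invf_lt1 ?ltr1n// ltr0n ltnW.
have u0 : 0 < 1 - p%:R^-1 :> R by rewrite subr_gt0.
have ut0 : 0 < 1 - p%:R^-1 * t.
  by rewrite subr_gt0 (le_lt_trans _ i1)// ler_piMr// invr_ge0.
have : ln ((1 - p%:R^-1 * t) / (1 - p%:R^-1)) <= (1 - t) / (p%:R - 1).
  have -> : (1 - p%:R^-1 * t) / (1 - p%:R^-1) = 1 + (1 - t) / (p%:R - 1).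
    by field; rewrite !gt_eqF//; lra.
  apply: le_ln1Dx; rewrite (@lt_le_trans _ _ 0)// ?ltrN10// divr_ge0//; lra.
rewrite ln_div ?posrE// => h.
have -> : (1 - t) / (p%:R * (p%:R - 1)) = (1 - t) / (p%:R - 1) - (1 - t) * p%:R^-1.
  by field; rewrite !gt_eqF//; lra.
have h2 : (1 - t) * p%:R^-1 <= (1 - t) * prime_log R p by rewrite ler_wpM2l// subr_ge0.
move: h h2; rewrite /prime_log; move: (ln _) (ln _) (_ / _) (_ * _^-1) => a b c e; lra.
Qed.

(** * Mertens' third theorem *)

(** For [p] in block [k], [z^(k+1) <= p^(-d) <= z^k]. The loss [1 - p^(-d) <= d log p]
in the lower bound for a factor adds up to at most [2 d]. *)
Lemma weighted_prime_sum_bounds (R : realType) (d : R) K : 0 < d ->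
  let z := expR (- d * ln 2) in
  let Z := \sum_(0 <= p < (2 ^ K).+1 | prime p) - ln (1 - zeta_term d p) in
  let X := \sum_(0 <= k < K) block (@prime_log R) k * z ^+ k.+1 in
  z * Z <= X /\ X <= Z + 2 * d.
Proof.
move=> d0 z Z X.
have z0 : 0 < z by exact: expR_gt0.
have zE k : z ^+ k = expR (- d * (k%:R * ln 2)).
  by rewrite /z -expRM_natl; congr expR; ring.
have tb k p : prime p -> (2 ^ k < p <= 2 ^ k.+1)%N ->
    z ^+ k.+1 <= expR (- d * ln (p%:R : R)) <= z ^+ k.
  move=> pp kp; have /andP[l1 l2] := ln_block R k p kp.
  by rewrite !zE !ler_expR !mulNr !lerN2 !ler_pM2l// l1 l2.
have t1 p : prime p -> 0 <= expR (- d * ln (p%:R : R)) <= 1.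
  move=> pp; rewrite expR_ge0 expR_le1 mulNr oppr_le0 mulr_ge0 ?(ltW d0)//.
  by rewrite ln_ge0// ler1n prime_gt0.
have ZE F : \sum_(0 <= p < (2 ^ K).+1 | prime p) F p = \sum_(0 <= k < K) block F k :> R.
  by rewrite -series_block.
split.
  rewrite /X /Z ZE mulr_sumr; apply: ler_sum => k _.
  rewrite /block mulr_sumr mulr_suml big_seq_cond [leRHS]big_seq_cond.
  apply: ler_sum => p; rewrite mem_index_iota ltnS => /andP[kp pp].
  have p1 := prime_gt1 pp.
  have /andP[L1 _] := prime_log_bounds R p p1.
  have L0 : 0 <= prime_log R p by apply: le_trans L1; rewrite invr_ge0.
  rewrite exprS [leRHS]mulrCA ler_pM2l//.
  apply: (le_trans (prime_factor_upper R _ p p1 (t1 p pp))).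
  by rewrite mulrC ler_wpM2l//; have /andP[] := tb k p pp kp.
apply: (@le_trans _ _ (Z + d * \sum_(0 <= p < (2 ^ K).+1 | prime p)
    ln p%:R / (p%:R * (p%:R - 1)))); last first.
  by rewrite lerD2l mulrC ler_pM2r// sum_ln_primes_le.
rewrite /X /Z !ZE mulr_sumr -big_split/=; apply: ler_sum => k _.
rewrite /block mulr_sumr mulr_suml -big_split/= big_seq_cond [leRHS]big_seq_cond.
apply: ler_sum => p; rewrite mem_index_iota ltnS => /andP[kp pp].
have p1 := prime_gt1 pp.
have /andP[L1 _] := prime_log_bounds R p p1.
have L0 : 0 <= prime_log R p by apply: le_trans L1; rewrite invr_ge0.
apply: (@le_trans _ _ (expR (- d * ln p%:R) * prime_log R p)).
  by rewrite mulrC ler_wpM2r//; have /andP[] := tb k p pp kp.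
apply: (le_trans (prime_factor_lower R _ p p1 (t1 p pp))).
rewrite lerD2l mulrA ler_wpM2r ?invr_ge0 ?mulr_ge0 ?subr_ge0 ?ler1n ?(ltnW p1)//.
by have := expR_ge1Dx (- d * ln (p%:R : R)); lra.
Qed.

(** For [d] small, the limit in [K] of the weighted sums lies between
[z log zeta + log(1 - z)] and [log zeta + 2 d + log(1 - z)], where
[1/d <= zeta <= 1 + 1/d] and [1 - z] is close to [d log 2]; both bounds are
[log log 2 + O(sqrt d)]. *)
Lemma block_prime_log_lim (R : realType) :
  series (fun k => block (@prime_log R) k - k.+1%:R^-1) @ \oo --> ln (ln 2 : R).
Proof.
pose c (k : nat) : R := block (@prime_log R) k - k.+1%:R^-1.
have /cvg_ex[C cC] := block_prime_log_cvg R; rewrite -/c in cC *.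
have [l1 l2] := ln2_bounds R; have l0 : 0 < ln 2 :> R by lra.
suff -> : ln (ln 2) = C by [].
apply/eqP; rewrite eq_sym -subr_eq0 -normr_le0; apply/ler_addgt0Pl => e e0.
rewrite addr0.
have e6 : 0 < e / 6 by lra.
have [N [eta eta0 HN]] := abel_uniform R c C cC _ e6.
(* The parameter [d] is taken to be a square so that
   [d * ln (1 / d) <= 2 * sqrt d] follows from [ln (1 / r) <= 1 / r]. *)
have [r [r0 r1 re reta]] : exists r : R, [/\ 0 < r, r < 1, r <= e / 6 & r < eta].
  exists (Num.min (1 / 2) (Num.min (e / 6) (eta / 2))); rewrite !lt_min !gt_min !ge_min.
  rewrite lexx orbT; split=> //; first by rewrite e6 !divr_gt0.
    by apply/orP; left; lra.
  by apply/orP; right; apply/orP; right; lra.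
pose d := r ^+ 2; have d0 : 0 < d by rewrite exprn_gt0.
have dr : d <= r by rewrite /d expr2 ler_piMr// ltW.
pose z := expR (- d * ln 2).
have z0 : 0 < z := expR_gt0 _.
have dl0 : 0 < d * ln 2 by rewrite mulr_gt0.
have dl1 : d * ln 2 <= d by rewrite ler_piMr// ltW.
have z1 : z < 1 by rewrite expR_lt1 mulNr oppr_lt0.
have zup : 1 - z <= d * ln 2 by have := expR_ge1Dx (- d * ln 2 : R); rewrite -/z; lra.
have zlo : d * ln 2 * z <= 1 - z.
  have := expR_ge1Dx (d * ln 2 : R).
  have -> : expR (d * ln 2) = z^-1 by rewrite /z mulNr expRN invrK.
  by rewrite -(ler_pM2r z0) mulVf ?gt_eqF//; lra.
have z1' : 0 < 1 - z by lra.
have [zeta /andP[ze1 ze2] zcv] := euler_product R d d0.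
have zeta0 : 0 < zeta by apply: lt_le_trans ze1; rewrite divr_gt0.
pose Z K := \sum_(0 <= p < (2 ^ K).+1 | prime p) - ln (1 - zeta_term d p).
have Zcv : Z @ \oo --> ln zeta.
  apply: (@cvg_comp _ _ _ (fun K => 2 ^ K)%N (fun N => \sum_(0 <= p < N.+1 | prime p) - ln (1 - zeta_term d p)) _ \oo) => //.
  apply/cvgnyPge => A; near=> K; apply: leq_trans (ltnW (ltn_expl _ (ltnSn 1))).
  by near: K; exact: nbhs_infty_ge.
have Mcv := ln_series R z z0 z1.
pose M K := \sum_(0 <= k < K) z ^+ k.+1 / k.+1%:R.
have XE K : \sum_(0 <= k < K) c k * z ^+ k.+1 =
    \sum_(0 <= k < K) block (@prime_log R) k * z ^+ k.+1 - M K.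
  rewrite /M -sumrB; apply: eq_bigr => k _; rewrite /c mulrBl.
  by congr (_ - _); rewrite mulrC.
have key K : (N <= K)%N -> z * Z K - M K <= C + e / 6 /\ C - e / 6 <= Z K + 2 * d - M K.
  move=> NK; have := HN z z0 _ z1 K NK; rewrite XE.
  have [b1 b2] := weighted_prime_sum_bounds R d K d0.
  rewrite -/z -/(Z K) in b1 b2.
  move=> /(_ ltac:(lra)); rewrite ler_norml => /andP[h1 h2]; split; lra.
(* Here [K] tends to infinity, with [d] fixed. *)
have up : C - e / 6 <= ln zeta + 2 * d - - ln (1 - z).
  have cv : (fun K => Z K + 2 * d - M K) @ \oo --> ln zeta + 2 * d - - ln (1 - z).
    by apply: cvgB => //; apply: cvgD => //; exact: cvg_cst.
  rewrite -(cvg_lim _ cv)//; apply: limr_ge; first exact: cvgP cv.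
  by near=> K; have [] := key K _ => //; near: K; exact: nbhs_infty_ge.
have lo : z * ln zeta - - ln (1 - z) <= C + e / 6.
  have cv : (fun K => z * Z K - M K) @ \oo --> z * ln zeta - - ln (1 - z).
    by apply: cvgB => //; apply: cvgM => //; exact: cvg_cst.
  rewrite -(cvg_lim _ cv)//; apply: limr_le; first exact: cvgP cv.
  by near=> K; have [] := key K _ => //; near: K; exact: nbhs_infty_ge.
have u1 : ln zeta + ln (1 - z) <= d + ln (ln 2).
  rewrite -lnM ?posrE//.
  apply: (@le_trans _ _ (ln ((1 + d) * ln 2))).
    rewrite ler_ln ?posrE ?mulr_gt0//; last lra.
    apply: (@le_trans _ _ ((1 + 1 / d) * (d * ln 2))); first by rewrite ler_pM// ltW.
    by rewrite mulrA mulrDl mul1r mulrAC mul1r mulfV ?gt_eqF// addrC.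
  rewrite lnM ?posrE//; last lra.
  by rewrite lerD2r; apply: le_ln1Dx; lra.
have u2 : ln (ln 2) - 2 * r - d <= z * ln zeta + ln (1 - z).
  have a1 : - ln d <= ln zeta.
    by rewrite -lnV ?posrE// ler_ln ?posrE ?invr_gt0//; move: ze1; rewrite mul1r.
  have a2 : ln d + ln (ln 2) - d * ln 2 <= ln (1 - z).
    have := zlo; rewrite -(@ler_ln R) ?posrE ?mulr_gt0// !lnM ?posrE ?mulr_gt0// expRK; lra.
  have a3 : - (2 * r) <= (1 - z) * ln d.
    have b1 : - ln r <= r^-1.
      by rewrite -lnV ?posrE// ltW// ln_sublinear// invr_gt0.
    rewrite /d lnXn// mulrnAr -mulr_natl.
    have b2 : (1 - z) * - ln r <= r.
      apply: (@le_trans _ _ (r ^+ 2 * r^-1)); last by rewrite expr2 mulfK ?gt_eqF.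
      apply: ler_pM => //; first exact: ltW.
        by rewrite oppr_ge0 ln_le0// ltW.
      by rewrite -/d; lra.
    lra.
  have a4 : z * - ln d <= z * ln zeta by rewrite ler_pM2l.
  lra.
by rewrite ler_norml; apply/andP; split; lra.
Unshelve. all: by end_near. Qed.

Definition mertens_prod {R : realType} (n : nat) : R :=
  \prod_(0 <= p < n.+1 | prime p) (1 - p%:R^-1).

Lemma prime_factor_gt0 (R : realType) p : prime p -> 0 < 1 - p%:R^-1 :> R.
Proof. by move=> pp; rewrite subr_gt0 invf_lt1 ?ltr1n ?ltr0n ?prime_gt1 ?prime_gt0. Qed.

Lemma mertens_prod_gt0 (R : realType) n : 0 < mertens_prod n :> R.
Proof. by apply: prodr_gt0 => p; exact: prime_factor_gt0. Qed.

Lemma mertens_prod_anti (R : realType) m n : (m <= n)%N ->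
  mertens_prod n <= mertens_prod m :> R.
Proof.
move=> mn; rewrite /mertens_prod (@big_cat_nat _ _ _ m.+1)//= ler_piMr//.
  by apply: ltW; apply: mertens_prod_gt0.
apply: Num.Theory.prodr_ile1 => p pp; rewrite (ltW (prime_factor_gt0 R p pp))/=.
by rewrite gerBl invr_ge0.
Qed.

(** The logarithm of the left-hand side is
[-(series of prime_log blocks - H_K) - (H_K - log K)]. *)
Lemma mertens_dyadic (R : realType) :
  (fun K => K%:R * mertens_prod (2 ^ K) : R) @ \oo --> expR (- euler_gamma R) / ln 2.
Proof.
have [l1 l2] := ln2_bounds R; have l0 : 0 < ln 2 :> R by lra.
pose c (k : nat) : R := block (@prime_log R) k - k.+1%:R^-1.
have E K : (0 < K)%N -> K%:R * mertens_prod (2 ^ K) =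
    expR (- series c K - (\sum_(1 <= k < K.+1) k%:R^-1 - ln (K%:R : R))).
  move=> K0; have KR : 0 < K%:R :> R by rewrite ltr0n.
  rewrite -[mertens_prod _]lnK ?posrE ?mertens_prod_gt0// -[X in X * _ = _]lnK ?posrE//.
  rewrite -expRD; congr expR; rewrite /mertens_prod ln_prod; last exact: prime_factor_gt0.
  have -> : series c K = series (block (@prime_log R)) K - \sum_(1 <= k < K.+1) k%:R^-1.
    by rewrite big_add1/= !seriesEnat/= sumrB.
  rewrite series_block /prime_log sumrN; move: (\sum_(_ <= _ < _ | _) _) => u.
  by ring.
have -> : expR (- euler_gamma R) / ln 2 = expR (- ln (ln 2) - euler_gamma R).
  by rewrite mulrC expRD; congr (_ * _); rewrite expRN lnK ?posrE.
have cv : (fun K => expR (- series c K - (\sum_(1 <= k < K.+1) k%:R^-1 - ln (K%:R : R)))) @ \oo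
    --> expR (- ln (ln 2) - euler_gamma R).
  apply: (@cvg_comp _ _ _ _ (@expR R) _ (nbhs (- ln (ln 2) - euler_gamma R))); last exact: continuous_expR.
  apply: cvgB; last exact: euler_gamma_cvg.
  by apply: cvgN; exact: block_prime_log_lim.
apply: cvg_trans cv; apply: near_eq_cvg; near=> K.
by rewrite E//; near: K; exact: nbhs_infty_gt.
Unshelve. all: by end_near. Qed.

Lemma mertens_dyadic0 (R : realType) :
  (fun K => mertens_prod (2 ^ K) : R) @ \oo --> (0 : R).
Proof.
have : (fun K => harmonic K * (K.+1%:R * mertens_prod (2 ^ K.+1)) : R) @ \oo -->
    (0 * (expR (- euler_gamma R) / ln 2)).
  apply: cvgM; first exact: cvg_harmonic.
  have := mertens_dyadic R.
  by rewrite -cvg_shiftS.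
rewrite mul0r => cv; rewrite -cvg_shiftS; apply: cvg_trans cv; apply: near_eq_cvg; near=> K.
by rewrite /harmonic/= mulrA mulVf ?mul1r.
Unshelve. all: by end_near. Qed.

Lemma truncn_log_cvg (R : realType) :
  (fun x : R => trunc_log 2 (Num.truncn x)) @ +oo --> \oo.
Proof.
apply/cvgnyPge => A; near=> x; apply: trunc_log_max => //.
have Ax : (2 ^ A)%:R <= x by near: x; apply: nbhs_pinfty_ge; rewrite num_real.
by rewrite truncn_ge_nat// (le_trans _ Ax).
Unshelve. all: by end_near. Qed.

(** For [2^k <= x <= 2^(k+1)], both factors are between their values at the two ends. *)
Lemma mertens_third (R : realType) :
  mertens_prod (Num.truncn x) * ln x @[x --> +oo] --> expR (- euler_gamma R).
Proof.
have [l1 l2] := ln2_bounds R; have l0 : 0 < ln 2 :> R by lra.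
pose h K : R := K%:R * mertens_prod (2 ^ K).
pose lo K : R := (h K.+1 - mertens_prod (2 ^ K.+1)) * ln 2.
pose hi K : R := (h K + mertens_prod (2 ^ K)) * ln 2.
have hcv := mertens_dyadic R; rewrite -/h in hcv.
have qcv := mertens_dyadic0 R.
set l := expR _.
have lE : l = (l / ln 2) * ln 2 by rewrite divfK// gt_eqF.
have locv : lo @ \oo --> l.
  rewrite [X in _ --> X]lE -[l / ln 2]subr0.
  apply: cvgM; last exact: cvg_cst.
  by apply: cvgB; [move: hcv|move: qcv]; rewrite -cvg_shiftS.
have hicv : hi @ \oo --> l.
  rewrite [X in _ --> X]lE -[l / ln 2]addr0.
  apply: cvgM; last exact: cvg_cst.
  exact: cvgD.
pose k (x : R) := trunc_log 2 (Num.truncn x).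
apply: (@squeeze_cvgr _ _ _ _ (lo \o k) (hi \o k)); last 2 first.
- by apply: cvg_comp locv; exact: truncn_log_cvg.
- by apply: cvg_comp hicv; exact: truncn_log_cvg.
near=> x; rewrite /= /lo /hi /h.
have x1 : 1 <= x by near: x; apply: nbhs_pinfty_ge; rewrite num_real.
have x0 : 0 < x by lra.
have n0 : (0 < Num.truncn x)%N by rewrite truncn_gt0.
have /andP[kn nk] := trunc_log_bounds (ltnSn 1) n0; rewrite -/(k x) in kn nk.
have /andP[nx xn] := truncn_itv (ltW x0).
have lnX j : ln (2 ^ j)%:R = j%:R * ln 2 :> R by rewrite natrX lnXn// mulr_natl.
have x2k : (2 ^ k x)%:R <= x by apply: le_trans nx; rewrite ler_nat.
have x2k1 : x <= (2 ^ (k x).+1)%:R.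
  by apply: (le_trans (ltW xn)); rewrite ler_nat.
have kx : (k x)%:R * ln 2 <= ln x by rewrite -lnX ler_ln ?posrE ?ltr0n ?expn_gt0.
have xk : ln x <= (k x).+1%:R * ln 2 by rewrite -lnX ler_ln ?posrE ?ltr0n ?expn_gt0.
have q1 : mertens_prod (2 ^ (k x).+1) <= mertens_prod (Num.truncn x) :> R.
  by apply: mertens_prod_anti; exact: ltnW.
have q2 : mertens_prod (Num.truncn x) <= mertens_prod (2 ^ k x) :> R.
  exact: mertens_prod_anti.
have q0 n : 0 <= mertens_prod n :> R by rewrite ltW// mertens_prod_gt0.
apply/andP; split.
  rewrite -[(k x).+1%:R]natr1 [(_ + 1) * _]mulrDl mul1r addrK mulrAC mulrC.
  by apply: ler_pM => //; rewrite mulr_ge0// ltW.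
have -> : ((k x)%:R * mertens_prod (2 ^ k x) + mertens_prod (2 ^ k x)) * ln 2 =
    mertens_prod (2 ^ k x) * ((k x).+1%:R * ln 2) :> R.
  by rewrite -[(k x).+1%:R]natr1; ring.
by apply: ler_pM => //; exact: ln_ge0.
Unshelve. all: by end_near. Qed.

(** * Residues of powers modulo primes *)

(** Moves congruences of integers into the field with [p] elements. *)
Lemma is_power_modP (g : int) p (n : int) : prime p ->
  is_power_mod g p n <-> exists k, n%:~R = g%:~R ^+ k :> 'F_p.
Proof.
move=> pp; have H k : (n = g ^+ k %[mod p])%Z <-> n%:~R = g%:~R ^+ k :> 'F_p.
  rewrite -rmorphXn/=; split.
    move/eqP; rewrite eqz_mod_dvd (dvdz_pcharf (pchar_Fp pp)) rmorphB/= subr_eq0.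
    by move/eqP.
  by move=> e; apply/eqP; rewrite eqz_mod_dvd (dvdz_pcharf (pchar_Fp pp)) rmorphB/= e subrr.
by split=> -[k /H]; exists k.
Qed.

Definition residue_count (g : int) (p : nat) : nat :=
  (\sum_(0 <= r < p) `[< is_power_mod g p r%:Z >])%N.

Lemma residue_count_dvd (g : int) p : prime p -> (p %| g)%Z -> residue_count g p = 2.
Proof.
move=> pp pg; have p1 := prime_gt1 pp.
have g0 : g%:~R = 0 :> 'F_p by apply/eqP; rewrite -(dvdz_pcharf (pchar_Fp pp)).
rewrite /residue_count big_ltn ?prime_gt0// big_ltn//.
rewrite asboolT; last by apply/is_power_modP => //; exists 1; rewrite g0.
rewrite asboolT; last by apply/is_power_modP => //; exists 0.
rewrite big_nat_cond big1// => r /andP[/andP[r2 rp] _].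
rewrite asboolF// => /(is_power_modP _ _ _ pp)[k].
have rn0 : (r%:Z)%:~R != 0 :> 'F_p.
  by rewrite -(dvdz_pcharf (pchar_Fp pp)) dvdzE/= gtnNdvd// (ltn_trans _ r2).
have rn1 : (r%:Z)%:~R != 1 :> 'F_p.
  rewrite -subr_eq0 -(mulr1z 1) -rmorphB/= -(dvdz_pcharf (pchar_Fp pp)).
  rewrite -[X in _ - X]/(1%N%:Z) subzn ?(ltnW r2)// dvdzE/= gtnNdvd// ?subn_gt0//.
  by rewrite (leq_ltn_trans _ rp)// leq_subr.
rewrite g0; case: k => [|k].
  by rewrite expr0 => e; rewrite e eqxx in rn1.
by rewrite exprS mul0r => e; rewrite e eqxx in rn0.
Qed.

Lemma mult_order_unit (g : int) p : prime p -> ~~ (p %| g)%Z ->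
  exists2 u : {unit 'F_p}, \val u = g%:~R & mult_order g p = #[u]%g.
Proof.
move=> pp pg; exists (insubd (1%g : {unit 'F_p}) (g%:~R : 'F_p)) => //.
by rewrite val_insubd unitfE -(dvdz_pcharf (pchar_Fp pp)) pg.
Qed.

(** The residues are those of the elements of the cyclic group generated by [g]. *)
Lemma residue_count_coprime (g : int) p : prime p -> ~~ (p %| g)%Z ->
  residue_count g p = mult_order g p.
Proof.
move=> pp pg; have [u uE ->] := mult_order_unit g p pp pg.
rewrite /residue_count -[X in (\sum_(0 <= r < X) _)%N](Fp_cast pp) big_mkord.
have -> : #[u]%g = #|(val @: <[u]>%g)| by rewrite card_imset//; exact: val_inj.
rewrite -sum1_card [RHS]big_mkcond/=; apply: eq_bigr => r _.
have -> : (r \in (val @: <[u]>%g)) = `[< is_power_mod g p (r : nat)%:Z >].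
  have rE : ((r : nat)%:Z)%:~R = r :> 'F_p by exact: natr_Zp.
  apply/idP/asboolP.
    move=> /imsetP[v /cycleP[k ->] ->]; apply/is_power_modP => //; exists k.
    by rewrite -uE -pmulrn natr_Zp FinRing.val_unitX.
  move=> /(is_power_modP _ _ _ pp)[k]; rewrite rE -uE => rk.
  by apply/imsetP; exists (u ^+ k)%g; rewrite ?mem_cycle// FinRing.val_unitX.
by case: `[< _ >].
Qed.

Lemma mult_order_mul_index (g : int) p : prime p -> ~~ (p %| g)%Z ->
  (mult_order g p * residual_index g p = p.-1)%N.
Proof.
move=> pp pg; rewrite /residual_index mulnC divnK//.
have [u _ ->] := mult_order_unit g p pp pg.
have -> : p.-1 = #|[set: {unit 'F_p}]%SET| by rewrite card_finField_unit card_Fp.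
rewrite orderE; apply: cardSg; exact: finset.subsetT.
Qed.

Lemma residue_count_gt0 (g : int) p : prime p -> (0 < residue_count g p)%N.
Proof.
move=> pp; have [pg|pg] := boolP (p %| g)%Z; first by rewrite residue_count_dvd.
rewrite residue_count_coprime//; have [u _ ->] := mult_order_unit g p pp pg.
exact: order_gt0.
Qed.

(** If the order [l] of [g] is less than [L], then [p] divides [g^l - 1], which is
nonzero because [2 <= |g|], and of absolute value less than [p]. *)
Lemma residue_count_ge (g : int) (p L : nat) : (2 <= `|g|)%N -> prime p ->
  (`|g| ^ L + 1 < p)%N -> (L <= residue_count g p)%N.
Proof.
move=> g2 pp pL.
case: L pL => // L pL.
have pg : ~~ (p %| g)%Z.
  rewrite dvdzE/= gtnNdvd//; first exact: ltnW.
  apply: leq_ltn_trans pL; rewrite -[X in (X <= _)%N]expn1.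
  by apply: leq_trans (leq_addr _ _); rewrite leq_exp2l.
rewrite residue_count_coprime//; have [u uE ->] := mult_order_unit g p pp pg.
rewrite leqNgt; apply/negP => ul.
have : (p %| g ^+ #[u]%g - 1)%Z.
  rewrite (dvdz_pcharf (pchar_Fp pp)) rmorphB/= rmorphXn/= -uE -FinRing.val_unitX expg_order.
  by rewrite subrr.
rewrite dvdzE/=; have o0 := order_gt0 u.
have go : (`|g| <= `|g ^+ #[u]%g|)%N.
  by rewrite abszX -[X in (X <= _)%N]expn1 leq_exp2l.
rewrite gtnNdvd//.
  rewrite absz_gt0 subr_eq0; apply/negP => /eqP e.
  by rewrite e in go; have := leq_trans g2 go.
apply: leq_ltn_trans pL.
have : (`|g ^+ #[u]%g - 1| <= `|g ^+ #[u]%g| + 1)%N.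
  by have := leqD_dist (g ^+ #[u]%g) 0 1; rewrite subr0 sub0r.
move=> /leq_trans; apply; rewrite leq_add2r abszX leq_exp2l//.
exact: ltnW.
Qed.

(** Reduction modulo [m] and [q] is a bijection onto the pairs of residues. *)
Lemma chinese_count (P Q : pred nat) m q : (0 < m)%N -> (0 < q)%N -> coprime m q ->
  (\sum_(0 <= i < m * q) (P (i %% m) && Q (i %% q)) =
   (\sum_(0 <= i < m) P i) * (\sum_(0 <= j < q) Q j))%N.
Proof.
move=> m0 q0 cmq; rewrite !big_mkord.
pose f (i : 'I_(m * q)) : 'I_m * 'I_q :=
  (Ordinal (ltn_pmod i m0), Ordinal (ltn_pmod i q0)).
have fi : injective f.
  move=> i j [/eqP im /eqP iq]; apply/val_inj/eqP => /=.
  have := chinese_remainder cmq i j; rewrite im iq/= !modn_small//.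
have fb : bijective f by apply: inj_card_bij => //; rewrite card_prod !card_ord.
rewrite big_distrlr/= pair_bigA/= (reindex f)/=; last exact: onW_bij.
by apply: eq_bigr => i _; case: (P _); case: (Q _).
Qed.

Lemma coprime_prod_primes p (s : seq nat) : prime p -> all prime s -> p \notin s ->
  coprime p (\prod_(q <- s) q).
Proof.
move=> pp ap ps; rewrite big_seq.
apply: (big_ind (coprime p)) => [|a b|q qs]; first exact: coprimen1.
  by rewrite coprimeMr => -> ->.
rewrite prime_coprime// dvdn_prime2 ?(allP ap q qs)//.
by apply/eqP => e; rewrite e qs in ps.
Qed.

Definition power_residue (g : int) (s : seq nat) (n : nat) : bool :=
  all (fun p => `[< is_power_mod g p n%:Z >]) s.

Lemma is_power_mod_modn (g : int) (p n : nat) :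
  is_power_mod g p (n %% p)%N%:Z <-> is_power_mod g p n%:Z.
Proof.
by rewrite /is_power_mod -modz_nat modz_mod.
Qed.

(** Induction on the list of primes: the condition at [p] depends on [n %% p], the
others on [n] modulo the product of the remaining primes. *)
Lemma count_power_residues (g : int) (s : seq nat) : uniq s -> all prime s ->
  (\sum_(0 <= n < \prod_(p <- s) p) power_residue g s n = \prod_(p <- s) residue_count g p)%N.
Proof.
elim: s => [|p s IH] /=; first by rewrite !big_nil big_nat1.
move=> /andP[ps us] /andP[pp ap]; rewrite !big_cons -IH//.
have s0 : (0 < \prod_(q <- s) q)%N.
  by rewrite big_seq; apply: prodn_cond_gt0 => q /(allP ap)/prime_gt0.
have cps := coprime_prod_primes p s pp ap ps.
rewrite /residue_count -chinese_count ?(prime_gt0 pp)//; apply: eq_bigr => n _.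
congr (nat_of_bool (_ && _)).
  by apply: asbool_equiv_eq; apply: iff_sym; exact: is_power_mod_modn.
apply: eq_in_all => q qs; apply: asbool_equiv_eq.
have qd : (q %| \prod_(q <- s) q)%N by rewrite (big_rem q)//= dvdn_mulr.
by rewrite -is_power_mod_modn -[in X in _ <-> X]is_power_mod_modn modn_dvdm.
Qed.

(** * The asymptotic count of pseudopowers *)

Definition primes_upto (n : nat) : seq nat := [seq p <- index_iota 0 n.+1 | prime p].

Lemma mem_primes_upto n p : (p \in primes_upto n) = prime p && (p <= n)%N.
Proof. by rewrite mem_filter mem_index_iota. Qed.

Lemma uniq_primes_upto n : uniq (primes_upto n).
Proof. by rewrite filter_uniq// iota_uniq. Qed.

Lemma all_prime_primes_upto n : all prime (primes_upto n).
Proof. exact: filter_all. Qed.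

Lemma primorialE (R : realType) (x : R) :
  primorial x = (\prod_(p <- primes_upto (Num.truncn x)) p)%N.
Proof. by rewrite big_filter big_mkord. Qed.

Lemma primorial_gt0 (R : realType) (x : R) : (0 < primorial x)%N.
Proof. by rewrite /primorial; apply: prodn_cond_gt0 => p; exact: prime_gt0. Qed.

Lemma index_prodE (R : realType) (g : int) (x : R) :
  index_prod g x =
    (\prod_(p <- primes_upto (Num.truncn x) | ~~ (p %| g)%Z) residual_index g p)%N.
Proof. by rewrite big_filter_cond big_mkord. Qed.

Lemma totient_radical (g : int) :
  totient (radical g) = (\prod_(p <- primes `|g|%N) p.-1)%N.
Proof.
rewrite /radical; have := primes_uniq `|g|%N.
have : all prime (primes `|g|%N) by apply/allP => p; rewrite mem_primes => /andP[].
elim: (primes _) => [|p s IH] /=; first by rewrite !big_nil.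
move=> /andP[pp ap] /andP[ps us]; rewrite !big_cons totient_coprime ?IH// ?totient_prime//.
exact: coprime_prod_primes.
Qed.

Lemma residue_product_gt0 (g : int) n :
  (0 < \prod_(p <- primes_upto n) residue_count g p)%N.
Proof.
rewrite big_seq; apply: prodn_cond_gt0 => p.
by rewrite mem_primes_upto => /andP[pp _]; exact: residue_count_gt0.
Qed.

(** Splits the product according to whether [p] divides [g]; the bound on [n] makes
every prime factor of [g] occur. *)
Lemma residue_total (g : int) n : g != 0 -> (`|g| <= n)%N ->
  (\prod_(p <- primes_upto n) residue_count g p *
   (totient (radical g) *
    \prod_(p <- primes_upto n | ~~ (p %| g)%Z) residual_index g p) =
   2 ^ prime_omega g * \prod_(p <- primes_upto n) p.-1)%N.
Proof.
move=> g0 gn.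
have Hp : perm_eq (primes `|g|%N) [seq p <- primes_upto n | (Posz p %| g)%Z].
  apply: uniq_perm; [exact: primes_uniq|by rewrite filter_uniq// uniq_primes_upto|].
  move=> p; rewrite mem_primes mem_filter mem_primes_upto absz_gt0 g0/= dvdzE/=.
  rewrite andbCA; case: (prime p) => //=; case: (boolP (p %| `|g|)%N) => //= pg.
  by rewrite (leq_trans _ gn)// dvdn_leq// absz_gt0.
rewrite totient_radical (perm_big _ Hp)/= big_filter.
rewrite (bigID (fun p : nat => (p %| g)%Z))/= [in RHS](bigID (fun p : nat => (p %| g)%Z))/=.
have -> : (\prod_(p <- primes_upto n | (p %| g)%Z) residue_count g p = 2 ^ prime_omega g)%N.
  rewrite /prime_omega (perm_size Hp) size_filter -iter_muln_1 -big_const_seq.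
  rewrite [LHS]big_seq_cond [RHS]big_seq_cond; apply: eq_bigr => p /andP[].
  by rewrite mem_primes_upto => /andP[pp _] pg; rewrite residue_count_dvd.
have -> : (\prod_(p <- primes_upto n | ~~ (p %| g)%Z) p.-1 =
    \prod_(p <- primes_upto n | ~~ (p %| g)%Z) residue_count g p *
    \prod_(p <- primes_upto n | ~~ (p %| g)%Z) residual_index g p)%N.
  rewrite -big_split/= [LHS]big_seq_cond [RHS]big_seq_cond; apply: eq_bigr => p /andP[].
  rewrite mem_primes_upto => /andP[pp _] pg.
  by rewrite residue_count_coprime// mult_order_mul_index.
by rewrite -!mulnA; congr (_ * _)%N; rewrite mulnCA.
Qed.

(** The product counts the integers in [(0, M]] that are powers modulo every
[p <= x]; those which are not pseudopowers are true powers [g^k], with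
[2^k <= |g|^k <= M]. *)
Lemma pseudopower_count_bounds (R : realType) (g : int) (x : R) : 2 <= `|g| -> 0 <= x ->
  let N := (\prod_(p <- primes_upto (Num.truncn x)) residue_count g p)%N in
  (pseudopower_count g x <= N)%N /\
  (N <= pseudopower_count g x + (trunc_log 2 (primorial x)).+1)%N.
Proof.
move=> g2 x0 N; set n := Num.truncn x in N *.
pose s := primes_upto n.
have ME : primorial x = (\prod_(p <- s) p)%N by rewrite primorialE.
set M := primorial x in ME *.
pose G := [seq (i : nat)%:Z | i <- [seq i <- index_iota 1 M.+1 | power_residue g s i]].
have M0 : (0 < M)%N := primorial_gt0 R x.
have sizeG : size G = N.
  rewrite size_map size_filter -sum1_count big_mkcond/=.
  rewrite /N -/s -count_power_residues ?uniq_primes_upto ?all_prime_primes_upto// -ME.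
  (* The modulus [M] has the residue 0 modulo every prime in [s]. *)
  have -> : (\sum_(0 <= i < M) power_residue g s i = \sum_(1 <= i < M.+1) power_residue g s i)%N.
    rewrite big_ltn// big_nat_recr//= addnC; congr (_ + nat_of_bool _)%N.
    apply: eq_in_all => q qs; apply: asbool_equiv_eq.
    have qM : (q %| M)%N by rewrite ME (big_rem q)//= dvdn_mulr.
    by rewrite -[in X in _ <-> X]is_power_mod_modn (eqP qM).
  by apply: eq_bigr => i _; case: (power_residue _ _ _).
have uG : uniq G.
  by rewrite map_inj_uniq ?filter_uniq ?iota_uniq// => a b [].
set A := pseudopowers g x `&` [set m : int | 0 < m <= M%:Z].
have resP m : power_residue g s m <-> forall p, prime p -> p%:R <= x -> is_power_mod g p m%:Z.
  split.
    by move=> /allP h p pp px; apply/asboolP/h; rewrite mem_primes_upto pp truncn_ge_nat.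
  move=> h; apply/allP => p; rewrite mem_primes_upto => /andP[pp pn].
  by apply/asboolP/h => //; rewrite -truncn_ge_nat.
have GP m : m \in G <-> 0 < m <= M%:Z /\ forall p, prime p -> p%:R <= x -> is_power_mod g p m.
  split.
    move=> /mapP[i]; rewrite mem_filter mem_index_iota => /andP[/resP h /andP[i1 iM]] ->.
    by split => //; rewrite ltz_nat i1.
  case: m => [m|m] [/andP[m0 mM] h]; last by [].
  rewrite ltz_nat in m0; rewrite lez_nat in mM.
  by apply: map_f; rewrite mem_filter mem_index_iota m0 ltnS mM /= andbT; apply/resP.
have AG : A `<=` [set` G] by move=> m [[m0 _ h] mM]; apply/GP.
have fA : finite_set A := sub_finite_set AG (finite_seq G).
have memA m : (m \in fset_set A) = `[< A m >] by rewrite in_fset_set// /in_mem.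
rewrite -sizeG /pseudopower_count -/M -/A; split.
  by apply: uniq_leq_size => // m; rewrite memA => /asboolP/AG.
pose W := [seq g ^+ k | k <- iota 0 (trunc_log 2 M).+1].
have -> : (trunc_log 2 M).+1 = size W by rewrite size_map size_iota.
rewrite -size_cat; apply: uniq_leq_size => // m mG; rewrite mem_cat memA.
have /GP[m0M h] := mG; have /andP[m0 mM] := m0M.
have [[k mk]|nm] := pselect (is_power g m); last first.
  by apply/orP; left; apply/asboolP.
apply/orP; right; apply/mapP; exists k => //; rewrite mem_iota/= add0n ltnS.
apply: trunc_log_max => //.
have mE : (`|g| ^ k <= M)%N.
  by rewrite -abszX -mk -lez_nat gez0_abs// ltW.
apply: leq_trans mE; have [->|k0] := posnP k; first by rewrite !expn0.
by rewrite leq_exp2r// -lez_nat.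
Qed.

(** Mertens' first theorem with [log p / p <= 1]; the logarithmic lower bound that
it gives is enough here. *)
Lemma size_primes_upto_lower (R : realType) K n : (2 ^ K <= n)%N ->
  K%:R <= 2 * (size (primes_upto n))%:R + 6 :> R.
Proof.
move=> Kn; have [l1 l2] := ln2_bounds R.
have := mertens_first R K; rewrite ler_norml => /andP[h _].
have : mertens_sum R (2 ^ K) <= (size (primes_upto n))%:R.
  apply: (@le_trans _ _ (size (primes_upto (2 ^ K)))%:R); last first.
    rewrite ler_nat; apply: uniq_leq_size; first exact: uniq_primes_upto.
    by move=> p; rewrite !mem_primes_upto => /andP[-> /leq_trans]; apply.
  rewrite /mertens_sum -big_filter -/(primes_upto _) -sum1_size natr_sum.
  rewrite big_seq [leRHS]big_seq; apply: ler_sum => p.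
  rewrite mem_primes_upto => /andP[pp _].
  have p0 : 0 < p%:R :> R by rewrite ltr0n prime_gt0.
  by rewrite ler_pdivrMr// mul1r ltW// ln_sublinear.
have : K%:R * (1 / 2) <= K%:R * ln 2 :> R by rewrite ler_wpM2l.
move: h; move: (K%:R * ln 2) (mertens_sum _ _) => u v; lra.
Qed.

(** All but boundedly many primes contribute a factor of at least 16; the
exceptional ones are paid for by the constant. *)
Lemma prod_residue_count_ge (g : int) n : (2 <= `|g|)%N ->
  (16 ^ size (primes_upto n) <=
   \prod_(p <- primes_upto n) residue_count g p * 16 ^ (`|g| ^ 16 + 1).+1)%N.
Proof.
move=> g2; set T := (`|g| ^ 16 + 1)%N; set s := primes_upto n.
have E : (16 ^ size s = \prod_(p <- s) 16)%N.
  by rewrite big_const_seq iter_muln_1 count_predT.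
apply: (@leq_trans (\prod_(p <- s) (residue_count g p * (if (p <= T)%N then 16 else 1)))%N).
  rewrite E big_seq [X in (_ <= X)%N]big_seq; apply: leq_prod => p.
  rewrite mem_primes_upto => /andP[pp _]; case: (leqP p T) => pT.
    by rewrite /= leq_pmull// residue_count_gt0.
  by rewrite muln1 residue_count_ge.
rewrite big_split/= leq_mul2l; apply/orP; right.
rewrite -big_mkcond big_const_seq iter_muln_1 leq_exp2l//.
rewrite -size_filter -[T.+1](size_iota 0); apply: uniq_leq_size.
  by rewrite filter_uniq ?uniq_primes_upto.
by move=> p; rewrite mem_filter mem_iota add0n ltnS => /andP[].
Qed.

Lemma trunc_log_primorial (R : realType) (x : R) K : 1 <= x ->
  K = trunc_log 2 (Num.truncn x) -> ((trunc_log 2 (primorial x)).+1 <= 5 * 2 ^ K)%N.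
Proof.
move=> x1 KE; have n0 : (0 < Num.truncn x)%N by rewrite truncn_gt0.
have := trunc_log_bounds (ltnSn 1) n0; rewrite /= -KE => /andP[_ nK].
have pM : (primorial x <= 2 ^ (4 * 2 ^ K))%N.
  apply: (@leq_trans (\prod_(0 <= p < (2 ^ K.+1).+1 | prime p) p)%N).
    rewrite primorialE big_filter (@big_cat_nat _ _ _ (Num.truncn x).+1 0 (2 ^ K.+1).+1)//=.
      by rewrite leq_pmulr// prodn_cond_gt0// => p; exact: prime_gt0.
    by rewrite ltnS ltnW.
  apply: (leq_trans (chebyshev_upper _)).
  by rewrite (_ : 4 = 2 ^ 2)%N// -expnM expnS mulnA.
have := leq_trunc_log 2 pM; rewrite trunc_expnK// => h.
by rewrite (_ : 5 = 4 + 1)%N// mulnDl mul1n -addn1 leq_add// expn_gt0.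
Qed.

(** With [2^K <= x < 2^(K+1)], the numerator is [O(2^K)], and the denominator is at
least a constant times [16^(K/2) = 4^K]. *)
Lemma powers_negligible (R : realType) (g : int) : (2 <= `|g|)%N ->
  (trunc_log 2 (primorial x)).+1%:R /
    (\prod_(p <- primes_upto (Num.truncn x)) residue_count g p)%N%:R
    @[x --> (+oo : set_system R)] --> (0 : R).
Proof.
move=> g2.
pose k (x : R) := trunc_log 2 (Num.truncn x).
(* [5 * 2 ^ K] bounds the numerator; the other factors turn [4 ^ K] into a lower
   bound for the denominator. *)
pose D : R := 5 * (4 ^+ 6 * 16 ^+ (`|g| ^ 16 + 1).+1).
apply: (@squeeze_cvgr _ _ _ _ (fun=> 0) ((fun K => D * (1 / 2) ^+ K) \o k)); last 2 first.
- exact: cvg_cst.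
- apply: (@cvg_comp _ _ _ _ _ _ \oo); first exact: truncn_log_cvg.
  suff : (fun K => D * (1 / 2) ^+ K) @ \oo --> D * 0 by rewrite mulr0.
  apply: cvgM; first exact: cvg_cst.
  by apply: cvg_expr; rewrite ger0_norm; lra.
near=> x.
have x1 : 1 <= x by near: x; apply: nbhs_pinfty_ge; rewrite num_real.
have n0 : (0 < Num.truncn x)%N by rewrite truncn_gt0.
set n := Num.truncn x in n0 *; set N := (\prod_(p <- _) _)%N.
have N0 : 0 < N%:R :> R.
  by rewrite ltr0n residue_product_gt0.
rewrite divr_ge0//= ler_pdivrMr//.
have L := trunc_log_primorial R x (k x) x1 erefl.
rewrite -(ler_nat R) natrM in L; apply: (le_trans L).
have H1 : 4 ^+ k x <= 4 ^+ 6 * (16 ^+ (`|g| ^ 16 + 1).+1 * N%:R) :> R.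
  apply: (@le_trans _ _ (4 ^+ 6 * 16 ^+ size (primes_upto n))).
    rewrite (_ : 16 = 4 ^+ 2) -?exprM -?exprD; last by rewrite expr2; ring.
    rewrite ler_weXn2l//.
      by lra.
    rewrite -(ler_nat R) natrD natrM addrC; apply: size_primes_upto_lower.
    exact: trunc_logP.
  rewrite ler_pM2l; last by rewrite exprn_gt0.
  have := prod_residue_count_ge g n g2.
  by rewrite -(ler_nat R) natrM !natrX mulrC.
rewrite /D /= natrX.
rewrite -(@ler_pM2r _ (2 ^+ k x)) ?exprn_gt0//.
rewrite (_ : 5 * 2 ^+ k x * 2 ^+ k x = 5 * 4 ^+ k x); last first.
  by rewrite -mulrA -exprMn; congr (_ * _ ^+ _); ring.
have -> : 5 * (4 ^+ 6 * 16 ^+ (`|g| ^ 16 + 1).+1) * (1 / 2) ^+ k x * N%:R * 2 ^+ k x =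
   5 * (4 ^+ 6 * (16 ^+ (`|g| ^ 16 + 1).+1 * N%:R)) * ((1 / 2) ^+ k x * 2 ^+ k x) :> R.
  by move: (4 ^+ 6) (16 ^+ _) ((1 / 2) ^+ _) (2 ^+ _) => *; ring.
rewrite -exprMn (_ : 1 / 2 * 2 = 1) ?expr1n ?mulr1; last by lra.
by rewrite ler_pM2l.
Unshelve. all: by end_near. Qed.

(** In the quotient of the main terms, everything but the product in Mertens' third
theorem cancels. *)
Lemma residue_ratio (R : realType) (g : int) (x : R) : g != 0 -> `|g|%N%:R <= x -> 1 < x ->
  (\prod_(p <- primes_upto (Num.truncn x)) residue_count g p)%N%:R /
   ((2 ^+ prime_omega g * (primorial x)%:R) /
         (expR (euler_gamma R) * (totient (radical g))%:R *
          (index_prod g x)%:R * ln x)) =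
  mertens_prod (Num.truncn x) * ln x * expR (euler_gamma R).
Proof.
move=> g0 gx x1; have x0 : 0 <= x by lra.
set n := Num.truncn x.
have gn : (`|g| <= n)%N by rewrite truncn_ge_nat.
have M0 := primorial_gt0 R x.
have PE : (\prod_(p <- primes_upto n) p.-1)%N%:R = (primorial x)%:R * mertens_prod n :> R.
  rewrite primorialE -/n /mertens_prod -[in X in _ * X]big_filter -/(primes_upto n).
  rewrite !natr_prod -big_split/= big_seq [RHS]big_seq; apply: eq_bigr => p.
  rewrite mem_primes_upto => /andP[pp _]; rewrite mulrBr mulr1 mulfV.
    by rewrite -subn1 natrB// prime_gt0.
  by rewrite pnatr_eq0 -lt0n prime_gt0.
have T := congr1 (fun m => m%:R : R) (residue_total g n g0 gn).
rewrite !natrM natrX PE -index_prodE in T.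
have I0 : (index_prod g x)%:R * (totient (radical g))%:R != 0 :> R.
  rewrite mulrC; apply/eqP => e; move: T; rewrite e mulr0 => /esym/eqP.
  rewrite !mulf_eq0 expf_eq0 pnatr_eq0 andbF/= pnatr_eq0 -[_ == 0%N]negbK -lt0n M0/=.
  by rewrite gt_eqF// mertens_prod_gt0.
have lx : 0 < ln x by rewrite ln_gt0.
move: I0; rewrite mulf_eq0 negb_or => /andP[i0 t0].
have p0 : 2 ^+ prime_omega g != 0 :> R by rewrite expf_neq0.
have m0 : (primorial x)%:R != 0 :> R by rewrite pnatr_eq0 -lt0n.
have e0 : expR (euler_gamma R) != 0 by rewrite gt_eqF// expR_gt0.
rewrite invf_div !mulrA mulrC !mulrA.
have -> : mertens_prod n = (\prod_(p <- primes_upto n) residue_count g p)%N%:R *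
  ((totient (radical g))%:R * (index_prod g x)%:R) / (2 ^+ prime_omega g * (primorial x)%:R) :> R.
  rewrite T; field; by rewrite p0 m0.
by field; rewrite p0 m0.
Qed.

Theorem mainTheorem5 (R : realType) (g : int) (hg : 2 <= `|g|) :
  exists2 e : R -> R, e x @[x --> +oo] --> (0 : R) &
    \forall x \near +oo,
      (pseudopower_count g x)%:R = (1 + e x) *
        ((2 ^+ prime_omega g * (primorial x)%:R) /
         (expR (euler_gamma R) * (totient (radical g))%:R *
          (index_prod g x)%:R * ln x)).
Proof.
have g2 : (2 <= `|g|)%N by rewrite -lez_nat.
have g0 : g != 0 by rewrite -absz_gt0 ltnW.
pose main (x : R) : R := (2 ^+ prime_omega g * (primorial x)%:R) /
         (expR (euler_gamma R) * (totient (radical g))%:R *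
          (index_prod g x)%:R * ln x).
pose N (x : R) : R := (\prod_(p <- primes_upto (Num.truncn x)) residue_count g p)%N%:R.
have N0 x : 0 < N x.
  by rewrite ltr0n residue_product_gt0.
have ratio1 : (pseudopower_count g x)%:R / N x @[x --> +oo] --> (1 : R).
  apply: (@squeeze_cvgr _ _ _ _
    (fun x => 1 - (trunc_log 2 (primorial x)).+1%:R / N x) (fun=> 1)); last 2 first.
  - suff : (fun x : R => 1 - (trunc_log 2 (primorial x)).+1%:R / N x) @ +oo --> (1 - 0 : R).
      by rewrite subr0.
    apply: cvgB; first exact: cvg_cst.
    exact: powers_negligible.
  - exact: cvg_cst.
  near=> x.
  have x0 : 0 <= x by near: x; apply: nbhs_pinfty_ge; rewrite num_real.
  have [b1 b2] := pseudopower_count_bounds R g x hg x0.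
  rewrite ler_pdivrMr// mul1r ler_nat b1 andbT ler_pdivlMr// mulrBl mul1r divfK ?gt_eqF//.
  by rewrite lerBlDr -natrD ler_nat.
have ratio2 : N x / main x @[x --> +oo] --> (1 : R).
  have cv : mertens_prod (Num.truncn x) * ln x * expR (euler_gamma R) @[x --> +oo] -->
      expR (- euler_gamma R) * expR (euler_gamma R).
    by apply: cvgM; [exact: mertens_third|exact: cvg_cst].
  rewrite -expRD addNr expR0 in cv.
  apply: cvg_trans cv; apply: near_eq_cvg; near=> x.
  have gx : `|g|%N%:R <= x by near: x; apply: nbhs_pinfty_ge; rewrite num_real.
  have x1 : 1 < x by near: x; apply: nbhs_pinfty_gt; rewrite num_real.
  by rewrite /main /N residue_ratio.
exists (fun x => (pseudopower_count g x)%:R / main x - 1).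
  have cv : (pseudopower_count g x)%:R / N x * (N x / main x) - 1 @[x --> +oo] --> (1 * 1 - 1 : R).
    by apply: cvgB; [exact: cvgM|exact: cvg_cst].
  rewrite mulr1 subrr in cv; apply: cvg_trans cv; apply: near_eq_cvg; near=> x.
  by rewrite mulrA divfK// gt_eqF.
near=> x.
have rp : 0 < N x / main x.
  near: x; apply: (cvgr_gt _ ratio2); exact: ltr01.
rewrite -/(main x) addrC subrK divfK//.
by apply/eqP => e; move: rp; rewrite e invr0 mulr0 ltxx.
Unshelve. all: by end_near. Qed.
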